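(* Suppose that the field $\Bbbk$ has characteristic zero and that $\mathscr{C}$ is locally self-injective. Then the following statements are equivalent: (1) $\operatorname{Ker}(\nu)\subseteq\mathscr{C}\text{-fdmod}$. (2) If $V$ is a finitely generated, infinite-dimensional left $\mathscr{C}$-module, then there exists $i\in I$ such that $\operatorname{Hom}_{\mathscr{C}}(V,Ae_i)\neq0$. (3) The category $\mathscr{C}\text{-mod}$ has enough injectives, and every finitely generated injective left $\mathscr{C}$-module is isomorphic to a direct sum of a finite-dimensional injective left $\mathscr{C}$-module and a finitely generated projective left $\mathscr{C}$-module.
   Context: Let $\Bbbk$ be a field. An EI-category is a small category in which every endomorphism is an isomorphism. $\mathscr{C}$ is a skeletal EI-category with object set $I$; $\mathscr{C}(i,j)$ is the set of morphisms from $i$ to $j$. A left (resp. right) $\mathscr{C}$-module is a covariant (resp. contravariant) functor from $\mathscr{C}$ to $\Bbbk$-vector spaces. Let $A=\bigoplus_{i,j\in I}\Bbbk\mathscr{C}(i,j)$ be the (possibly non-unital) category algebra, with multiplication given by composition of morphisms (zero when not composable), and let $e_i\in\mathscr{C}(i,i)$ be the identity of $i$. A left (resp. right) $A$-module $V$ is graded if $V=\bigoplus_{i}e_iV$ (resp. $V=\bigoplus_i Ve_i$). Left (right) $\mathscr{C}$-modules $W$ are identified with graded left (right) $A$-modules via $W\mapsto\bigoplus_i W(i)$; thus $Ae_i$ is the left $\mathscr{C}$-module $j\mapsto\Bbbk\mathscr{C}(i,j)$. A module is finitely generated (resp. finite-dimensional) if it is so as a graded $A$-module. $\mathscr{C}\text{-mod}$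 is the category of finitely generated left $\mathscr{C}$-modules, and $\mathscr{C}\text{-fdmod}$ is its full subcategory of finite-dimensional modules. Standing assumptions: $\mathscr{C}$ is inwards finite (for each $j\in I$ there are only finitely many $i\in I$ with $\mathscr{C}(i,j)\neq\emptyset$), hom-finite (each $\mathscr{C}(i,j)$ is finite), and locally noetherian (every submodule of a finitely generated left $\mathscr{C}$-module is finitely generated). For $V$ in $\mathscr{C}\text{-mod}$, $\operatorname{Hom}_{\mathscr{C}}(V,A)\cong\bigoplus_{i\in I}\operatorname{Hom}_{\mathscr{C}}(V,Ae_i)$ is a finite-dimensional right $\mathscr{C}$-module (via right multiplication on $A$). Let $D=\operatorname{Hom}_{\Bbbk}(-,\Bbbk)$ be the standard duality between finite-dimensional left and finite-dimensional right $\mathscr{C}$-modules. The Nakayama functor is $\nu=D\circ\operatorname{Hom}_{\mathscr{C}}(-,A):\mathscr{C}\text{-mod}\to\mathscr{C}\text{-fdmod}$, and $\operatorname{Ker}(\nu)$ is the full subcategory of $\mathscr{C}\text{-mod}$ on the objects $V$ with $\nu(V)=0$. $\mathscr{C}$ is locally self-injective if $Ae_i$ is an injective left $\mathscr{C}$-module for every $i\in I$. *)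

(* Defs.v *)
From HB Require Import structures.
From mathcomp Require Import all_boot all_algebra.
From mathcomp Require Import boolp classical_sets functions cardinality.

Set Implicit Arguments.
Unset Strict Implicit.
Unset Printing Implicit Defensive.

Import GRing.Theory.

Local Open Scope classical_set_scope.
Local Open Scope ring_scope.

(* Small hom-finite categories; [ccomp g f] is "g after f". *)
Record hfcat := HFCat {
  obj :> Type;
  chom : obj -> obj -> finType;
  idm : forall i, chom i i;
  ccomp : forall i j k, chom j k -> chom i j -> chom i k;
  comp_idl : forall i j (f : chom i j), ccomp (idm j) f = f;
  comp_idr : forall i j (f : chom i j), ccomp f (idm i) = f;
  compA : forall i j k l (h : chom k l) (g : chom j k) (f : chom i j),
    ccomp h (ccomp g f) = ccomp (ccomp h g) f }.

Arguments chom {_} _ _.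
Arguments idm {_} _.
Arguments ccomp {_ _ _ _} _ _.

Definition opcat (C : hfcat) : hfcat :=
  @HFCat C (fun i j => @chom C j i) (fun i => idm i)
    (fun _ _ _ g f => ccomp f g)
    (fun _ _ f => comp_idr f) (fun _ _ f => comp_idl f)
    (fun _ _ _ _ h g f => esym (compA f g h)).

Section CategoryProperties.
Variable C : hfcat.

Definition is_iso (i j : C) (f : chom i j) : Prop :=
  exists g : chom j i, ccomp g f = idm i /\ ccomp f g = idm j.

Definition EI_category : Prop := forall (i : C) (f : chom i i), is_iso f.

Definition skeletal : Prop := forall (i j : C) (f : chom i j), is_iso f -> i = j.

Definition inwards_finite : Prop :=
  forall j : C, finite_set [set i : C | inhabited (chom i j)].

End CategoryProperties.

Record lmodule (K : fieldType) (C : hfcat) := LModule {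
  lm_obj :> C -> lmodType K;
  lact : forall i j : C, chom i j -> {linear lm_obj i -> lm_obj j};
  act_id : forall i (x : lm_obj i), lact (idm i) x = x;
  act_comp : forall i j k (g : chom j k) (f : chom i j) (x : lm_obj i),
    lact (ccomp g f) x = lact g (lact f x) }.

Arguments lact {K C} _ {i j} _.

Definition rmodule (K : fieldType) (C : hfcat) := lmodule K (opcat C).

Record lmorph (K : fieldType) (C : hfcat) (V W : lmodule K C) := LMorph {
  mor :> forall i : C, {linear V i -> W i};
  mor_nat : forall (i j : C) (f : chom i j) (x : V i),
    mor j (lact V f x) = lact W f (mor i x) }.

Lemma linear_eqP (K : fieldType) (U V : lmodType K) (f g : {linear U -> V}) :
  f =1 g -> f = g.
Proof.
case: f g => [f [[fa] [fb] ]] [g [[ga] [gb] ]] /= /funext fg.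
rewrite fg in fa fb *.
by rewrite (Prop_irrelevance fa ga) (Prop_irrelevance fb gb).
Qed.

Lemma lmorph_eqP (K : fieldType) (C : hfcat) (V W : lmodule K C)
  (f g : lmorph V W) : (forall i, f i =1 g i) -> f = g.
Proof.
case: f g => [f fn] [g gn] /= fg.
have E : f = g by apply/functional_extensionality_dep => i; exact/linear_eqP/fg.
by subst g; rewrite (Prop_irrelevance fn gn).
Qed.

Section Morphisms.
Variables (K : fieldType) (C : hfcat).
Implicit Types U V W : lmodule K C.

Definition lmorph_id V : lmorph V V :=
  @LMorph _ _ V V (fun i => idfun) (fun _ _ _ _ => erefl).

Lemma lmorph_comp_nat U V W (g : lmorph V W) (f : lmorph U V)
  (i j : C) (h : chom i j) (x : U i) :
  g j (f j (lact U h x)) = lact W h (g i (f i x)).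
Proof. by rewrite !mor_nat. Qed.

Definition lmorph_comp U V W (g : lmorph V W) (f : lmorph U V) : lmorph U W :=
  @LMorph _ _ U W (fun i => g i \o f i) (lmorph_comp_nat g f).

Definition isomorphic V W : Prop :=
  exists (f : lmorph V W) (g : lmorph W V),
    lmorph_comp g f = lmorph_id V /\ lmorph_comp f g = lmorph_id W.

Definition lmono V W (f : lmorph V W) : Prop := forall i, injective (f i).

Definition lepi V W (f : lmorph V W) : Prop :=
  forall i (y : W i), exists x : V i, f i x = y.

Definition is_zero V : Prop := forall i (x : V i), x = 0.

End Morphisms.

Section DirectSum.
Variables (K : fieldType) (C : hfcat) (V W : lmodule K C).

Definition dsum_act (i j : C) (f : chom i j) (x : V i * W i) : V j * W j :=
  (lact V f x.1, lact W f x.2).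

Lemma dsum_act_linear i j (f : chom i j) : linear (dsum_act f).
Proof. by move=> a x y; rewrite /dsum_act /= !linearP. Qed.

HB.instance Definition _ (i j : C) (f : chom i j) :=
  GRing.isLinear.Build K (V i * W i)%type (V j * W j)%type _ (dsum_act f)
    (dsum_act_linear f).

Lemma dsum_act_id i x : dsum_act (idm i) x = x.
Proof. by case: x => x y; rewrite /dsum_act !act_id. Qed.

Lemma dsum_act_comp i j k (g : chom j k) (f : chom i j) x :
  dsum_act (ccomp g f) x = dsum_act g (dsum_act f x).
Proof. by rewrite /dsum_act !act_comp. Qed.

Definition dsum : lmodule K C :=
  @LModule K C (fun i => (V i * W i)%type) (fun i j f => dsum_act f)
    dsum_act_id dsum_act_comp.

End DirectSum.

Section Finiteness.
Variables (K : fieldType) (C : hfcat).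

Record is_submodule (V : lmodule K C) (S : forall i, set (V i)) : Prop :=
  IsSubmodule {
    submod_zero : forall i, S i 0;
    submod_linear : forall i (a : K) (x y : V i), S i x -> S i y -> S i (a *: x + y);
    submod_act : forall i j (f : chom i j) (x : V i), S i x -> S j (lact V f x) }.

(* Generation over the category algebra by finitely many homogeneous elements
   [b k] of degree [d k]: each element of degree [j] is a sum of
   [(\sum_f a k f f) b k] where [f] runs over the morphisms [d k -> j]. *)
Definition sub_finitely_generated (V : lmodule K C) (S : forall i, set (V i)) :
    Prop :=
  exists (n : nat) (d : 'I_n -> C) (b : forall k, V (d k)),
    (forall k, S (d k) (b k)) /\
    forall j (x : V j), S j x ->
      exists a : forall k, chom (d k) j -> K,
        x = \sum_(k < n) \sum_(f : chom (d k) j) a k f *: lact V f (b k).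

Definition finitely_generated (V : lmodule K C) : Prop :=
  @sub_finitely_generated V (fun i => setT).

(* An element of the direct sum of the [V i] is a finitely supported family. *)
Definition finsupp (V : lmodule K C) (x : forall i, V i) : Prop :=
  finite_set [set i | x i <> 0].

Definition finite_dimensional (V : lmodule K C) : Prop :=
  exists (n : nat) (b : 'I_n -> forall i, V i),
    (forall k, finsupp (b k)) /\
    forall x : forall i, V i, finsupp x ->
      exists a : 'I_n -> K, forall i, x i = \sum_(k < n) a k *: b k i.

Definition locally_noetherian : Prop :=
  forall V : lmodule K C, finitely_generated V ->
  forall S : forall i, set (V i), is_submodule S -> sub_finitely_generated S.

(* Injectivity in the full subcategory of left modules satisfying [P]. *)
Definition injective_in (P : lmodule K C -> Prop) (E : lmodule K C) : Prop :=
  forall (X Y : lmodule K C) (m : lmorph X Y) (f : lmorph X E),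
    P X -> P Y -> lmono m -> exists g : lmorph Y E, lmorph_comp g m = f.

Definition injective_module (E : lmodule K C) : Prop :=
  injective_in (fun _ => True) E.

Definition projective_module (Q : lmodule K C) : Prop :=
  forall (X Y : lmodule K C) (p : lmorph X Y) (f : lmorph Q Y),
    lepi p -> exists g : lmorph Q X, lmorph_comp p g = f.

Definition fgmod_enough_injectives : Prop :=
  forall V : lmodule K C, finitely_generated V ->
    exists (E : lmodule K C) (m : lmorph V E),
      [/\ finitely_generated E, injective_in finitely_generated E & lmono m].

End Finiteness.

(* The left module A e_i, i.e. j |-> K C(i, j). *)
Section Free.
Variables (K : fieldType) (C : hfcat).

Definition lmul (i j k : C) (g : chom j k) (a : {ffun chom i j -> K^o}) :
    {ffun chom i k -> K^o} :=
  [ffun h => \sum_(f | ccomp g f == h) a f].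

Definition rmul (i j k : C) (f : chom i j) (a : {ffun chom j k -> K^o}) :
    {ffun chom i k -> K^o} :=
  [ffun h => \sum_(g | ccomp g f == h) a g].

Lemma lmul_linear i j k (g : chom j k) : linear (@lmul i j k g).
Proof.
move=> c a b; apply/ffunP => h; rewrite !ffunE scaler_sumr -big_split /=.
by apply: eq_bigr => f _; rewrite !ffunE.
Qed.

Lemma rmul_linear i j k (f : chom i j) : linear (@rmul i j k f).
Proof.
move=> c a b; apply/ffunP => h; rewrite !ffunE scaler_sumr -big_split /=.
by apply: eq_bigr => g _; rewrite !ffunE.
Qed.

HB.instance Definition _ i j k (g : chom j k) :=
  GRing.isLinear.Build K {ffun chom i j -> K^o} {ffun chom i k -> K^o} _
    (@lmul i j k g) (lmul_linear g).

HB.instance Definition _ i j k (f : chom i j) :=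
  GRing.isLinear.Build K {ffun chom j k -> K^o} {ffun chom i k -> K^o} _
    (@rmul i j k f) (rmul_linear f).

Lemma sum_fiber (X Y : finType) (F : X -> Y)
  (a : X -> K^o) (P : pred Y) :
  \sum_(y | P y) \sum_(x | F x == y) a x = \sum_(x | P (F x)) a x.
Proof.
rewrite [RHS](partition_big F P) //=.
apply: eq_bigr => y Py; apply: eq_bigl => x.
by case: eqP => [->|]; rewrite ?Py ?andbF.
Qed.

Lemma lmul_id i j (a : {ffun chom i j -> K^o}) : lmul (idm j) a = a.
Proof.
apply/ffunP => h; rewrite ffunE.
by under eq_bigl do rewrite comp_idl; rewrite big_pred1_eq.
Qed.

Lemma rmul_id i j (a : {ffun chom i j -> K^o}) : rmul (idm i) a = a.
Proof.
apply/ffunP => h; rewrite ffunE.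
by under eq_bigl do rewrite comp_idr; rewrite big_pred1_eq.
Qed.

Lemma lmul_comp i j k l (g : chom k l) (f : chom j k) (a : {ffun chom i j -> K^o}) :
  lmul (ccomp g f) a = lmul g (lmul f a).
Proof.
apply/ffunP => h; rewrite !ffunE; under [RHS]eq_bigr do rewrite ffunE.
rewrite (@sum_fiber _ _ (fun u => ccomp f u)) //.
by apply: eq_bigl => u; rewrite compA.
Qed.

Lemma rmul_comp i j k l (g : chom j k) (f : chom i j) (a : {ffun chom k l -> K^o}) :
  rmul (ccomp g f) a = rmul f (rmul g a).
Proof.
apply/ffunP => h; rewrite !ffunE; under [RHS]eq_bigr do rewrite ffunE.
rewrite (@sum_fiber _ _ (fun u => ccomp u g)) //.
by apply: eq_bigl => u; rewrite compA.
Qed.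

Lemma rmul_lmul i j k l (f : chom i j) (g : chom k l) (a : {ffun chom j k -> K^o}) :
  rmul f (lmul g a) = lmul g (rmul f a).
Proof.
apply/ffunP => h; rewrite !ffunE.
under eq_bigr do rewrite ffunE; under [RHS]eq_bigr do rewrite ffunE.
rewrite (@sum_fiber _ _ (fun u => ccomp g u)) //.
rewrite (@sum_fiber _ _ (fun u => ccomp u f)) //.
by apply: eq_bigl => u; rewrite compA.
Qed.

Definition Ae (i : C) : lmodule K C :=
  @LModule K C (fun j => {ffun chom i j -> K^o}) (fun j k g => @lmul i j k g)
    (@lmul_id i) (fun j k l g f => @lmul_comp i j k l g f).

(* Right multiplication by a morphism [f : i -> j] of C, as a morphism
   A e_j -> A e_i of left modules. *)
Definition Ae_rmul (i j : C) (f : chom i j) : lmorph (Ae j) (Ae i) :=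
  @LMorph K C (Ae j) (Ae i) (fun k => @rmul i j k f)
    (fun k l g a => rmul_lmul f g a).

Definition locally_self_injective : Prop :=
  forall i : C, injective_module (Ae i).

End Free.

Section HomSpace.
Variables (K : fieldType) (C : hfcat) (V W : lmodule K C).
Implicit Types f g h : lmorph V W.

Lemma lmorph_zero_nat (i j : C) (u : chom i j) (x : V i) :
  0 = lact W u 0.
Proof. by rewrite linear0. Qed.

Definition lmorph_zero : lmorph V W :=
  @LMorph K C V W (fun i => \0) lmorph_zero_nat.

Lemma lmorph_add_nat f g (i j : C) (u : chom i j) (x : V i) :
  f j (lact V u x) + g j (lact V u x) = lact W u (f i x + g i x).
Proof. by rewrite linearD !mor_nat. Qed.

Definition lmorph_add f g : lmorph V W :=
  @LMorph K C V W (fun i => f i \+ g i) (lmorph_add_nat f g).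

Lemma lmorph_opp_nat f (i j : C) (u : chom i j) (x : V i) :
  - f j (lact V u x) = lact W u (- f i x).
Proof. by rewrite linearN !mor_nat. Qed.

Definition lmorph_opp f : lmorph V W :=
  @LMorph K C V W (fun i => \- f i) (lmorph_opp_nat f).

Lemma lmorph_scale_nat (a : K) f (i j : C) (u : chom i j) (x : V i) :
  a *: f j (lact V u x) = lact W u (a *: f i x).
Proof. by rewrite linearZ /= !mor_nat. Qed.

Definition lmorph_scale (a : K) f : lmorph V W :=
  @LMorph K C V W (fun i => a \*: f i) (lmorph_scale_nat a f).

HB.instance Definition _ := gen_eqMixin (lmorph V W).
HB.instance Definition _ := gen_choiceMixin (lmorph V W).

Lemma lmorph_addA : associative lmorph_add.
Proof. by move=> f g h; apply: lmorph_eqP => i x /=; rewrite addrA. Qed.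
Lemma lmorph_addC : commutative lmorph_add.
Proof. by move=> f g; apply: lmorph_eqP => i x /=; rewrite addrC. Qed.
Lemma lmorph_add0 : left_id lmorph_zero lmorph_add.
Proof. by move=> f; apply: lmorph_eqP => i x /=; rewrite add0r. Qed.
Lemma lmorph_addN : left_inverse lmorph_zero lmorph_opp lmorph_add.
Proof. by move=> f; apply: lmorph_eqP => i x /=; rewrite addNr. Qed.

HB.instance Definition _ :=
  GRing.isZmodule.Build (lmorph V W)
    lmorph_addA lmorph_addC lmorph_add0 lmorph_addN.

Lemma lmorph_scaleA a b f :
  lmorph_scale a (lmorph_scale b f) = lmorph_scale (a * b) f.
Proof. by apply: lmorph_eqP => i x /=; rewrite scalerA. Qed.
Lemma lmorph_scale1 : left_id 1 lmorph_scale.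
Proof. by move=> f; apply: lmorph_eqP => i x /=; rewrite scale1r. Qed.
Lemma lmorph_scaleDr : right_distributive lmorph_scale +%R.
Proof. by move=> a f g; apply: lmorph_eqP => i x /=; rewrite scalerDr. Qed.
Lemma lmorph_scaleDl f : {morph lmorph_scale^~ f : a b / a + b}.
Proof. by move=> a b; apply: lmorph_eqP => i x /=; rewrite scalerDl. Qed.

HB.instance Definition _ :=
  GRing.Zmodule_isLmodule.Build K (lmorph V W)
    lmorph_scaleA lmorph_scale1 lmorph_scaleDr lmorph_scaleDl.

End HomSpace.

Section Dual.
Variables (K : fieldType) (U : lmodType K).

Definition kdual : Type := {linear U -> K^o}.

HB.instance Definition _ := gen_eqMixin kdual.
HB.instance Definition _ := gen_choiceMixin kdual.

Implicit Types f g h : kdual.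

Definition dual_zero : kdual := (\0 : {linear U -> K^o}).
Definition dual_add f g : kdual :=
  ((f : {linear U -> K^o}) \+ (g : {linear U -> K^o}) : {linear U -> K^o}).
Definition dual_opp f : kdual :=
  (\- (f : {linear U -> K^o}) : {linear U -> K^o}).
Definition dual_scale (a : K) f : kdual :=
  (a \*: (f : {linear U -> K^o}) : {linear U -> K^o}).

Lemma dual_addA : associative dual_add.
Proof. by move=> f g h; apply: linear_eqP => x /=; rewrite addrA. Qed.
Lemma dual_addC : commutative dual_add.
Proof. by move=> f g; apply: linear_eqP => x /=; rewrite addrC. Qed.
Lemma dual_add0 : left_id dual_zero dual_add.
Proof. by move=> f; apply: linear_eqP => x /=; rewrite add0r. Qed.
Lemma dual_addN : left_inverse dual_zero dual_opp dual_add.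
Proof. by move=> f; apply: linear_eqP => x /=; rewrite addNr. Qed.

HB.instance Definition _ :=
  GRing.isZmodule.Build kdual dual_addA dual_addC dual_add0 dual_addN.

Lemma dual_scaleA a b f : dual_scale a (dual_scale b f) = dual_scale (a * b) f.
Proof. by apply: linear_eqP => x /=; rewrite scalerA. Qed.
Lemma dual_scale1 : left_id 1 dual_scale.
Proof. by move=> f; apply: linear_eqP => x /=; rewrite scale1r. Qed.
Lemma dual_scaleDr : right_distributive dual_scale +%R.
Proof. by move=> a f g; apply: linear_eqP => x /=; rewrite scalerDr. Qed.
Lemma dual_scaleDl f : {morph dual_scale^~ f : a b / a + b}.
Proof. by move=> a b; apply: linear_eqP => x /=; rewrite scalerDl. Qed.

HB.instance Definition _ :=
  GRing.Zmodule_isLmodule.Build K kdual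
    dual_scaleA dual_scale1 dual_scaleDr dual_scaleDl.

End Dual.

(* The right module i |-> Hom_C(V, A e_i). *)
Section HomA.
Variables (K : fieldType) (C : hfcat) (V : lmodule K C).

Definition homA_act (i j : C) (f : chom i j) (u : lmorph V (Ae K j)) :
    lmorph V (Ae K i) :=
  lmorph_comp (Ae_rmul K f) u.

Lemma homA_act_linear i j (f : chom i j) : linear (homA_act f).
Proof.
move=> a u v; apply: lmorph_eqP => k x.
exact: (linearP (mor (Ae_rmul K f) k)).
Qed.

HB.instance Definition _ (i j : C) (f : chom i j) :=
  GRing.isLinear.Build K (lmorph V (Ae K j)) (lmorph V (Ae K i)) _
    (homA_act f) (homA_act_linear f).

Lemma homA_act_id i u : homA_act (idm i) u = u.
Proof. by apply: lmorph_eqP => k x; exact: rmul_id. Qed.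

Lemma homA_act_comp i j k (f : chom i j) (g : chom j k) u :
  homA_act (ccomp g f) u = homA_act f (homA_act g u).
Proof. by apply: lmorph_eqP => l x; exact: rmul_comp. Qed.

Definition homA : rmodule K C :=
  @LModule K (opcat C) (fun i : C => lmorph V (Ae K i)) (fun i j f => homA_act f)
    homA_act_id (fun i j k f g u => homA_act_comp f g u).

End HomA.

(* The duality Hom_K(-, K) from right to left modules. *)
Section Duality.
Variables (K : fieldType) (C : hfcat) (M : rmodule K C).

Definition stdual_act (i j : C) (f : chom i j) (u : kdual (M i)) : kdual (M j) :=
  ((u : {linear M i -> K^o}) \o lact M (f : @chom (opcat C) j i)
    : {linear M j -> K^o}).

Lemma stdual_act_linear (i j : C) (f : chom i j) : linear (stdual_act f).
Proof. by move=> a u v; apply: linear_eqP => x. Qed.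

HB.instance Definition _ (i j : C) (f : chom i j) :=
  GRing.isLinear.Build K (kdual (M i)) (kdual (M j)) _ (stdual_act f) (stdual_act_linear f).

Lemma stdual_act_id (i : C) (u : kdual (M i)) : stdual_act (idm i) u = u.
Proof.
by apply: linear_eqP => x /=; rewrite (@act_id K (opcat C) M i).
Qed.

Lemma stdual_act_comp (i j k : C) (g : chom j k) (f : chom i j) (u : kdual (M i)) :
  stdual_act (ccomp g f) u = stdual_act g (stdual_act f u).
Proof.
by apply: linear_eqP => x /=; rewrite (@act_comp K (opcat C) M k j i f g).
Qed.

Definition stdual : lmodule K C :=
  @LModule K C (fun i : C => kdual (M i)) (fun i j f => stdual_act f)
    stdual_act_id stdual_act_comp.

End Duality.

(* The Nakayama functor, on objects. *)
Definition nakayama (K : fieldType) (C : hfcat) (V : lmodule K C) :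
    lmodule K C :=
  stdual (homA V).

(* The objects of the kernel of the Nakayama functor on finitely generated
   modules. *)
Definition in_ker_nakayama (K : fieldType) (C : hfcat) (V : lmodule K C) :
    Prop :=
  finitely_generated V /\ is_zero (nakayama V).

(* Main.v *)
Require Import Defs.
From HB Require Import structures.
From mathcomp Require Import all_boot all_algebra.
From mathcomp Require Import boolp classical_sets cardinality.

(* (1) <-> (2): evaluation at an element and a morphism gives enough functionals
   on Hom(V, A e_i) to detect a nonzero map.

   (2) -> (3): let T be the common kernel of all maps from V to the A e_i. As
   the A e_i are injective, T has no nonzero map to them, so T is
   finite-dimensional by (2) and embeds in a finite-dimensional (cofree)
   injective X. Finitely many maps to the A e_i already have common kernel T, so
   V embeds in X (+) Y with Y a finite sum of modules A e_i. If V = E is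
   injective and K is the kernel of E -> Y, let Q be maximal with Q cap K = 0
   and F maximal with K in F and F cap Q = 0; then E = F (+) Q, where F
   embeds in X and Q embeds in Y, hence is a summand of Y.

   (3) -> (2): an infinite-dimensional V inside F (+) Q has nonzero image in Q,
   which is a summand of a finite sum of modules A e_i. *)

Set Implicit Arguments.
Unset Strict Implicit.
Unset Printing Implicit Defensive.

Import GRing.Theory.
Local Open Scope ring_scope.

(** * Submodules and standard morphisms *)

(** Classical decidable equality on [T] allows duplicates to be removed from an enumeration.
    Injectivity of [c] later keeps objects of a support from being counted twice. *)
Lemma finite_set_enum (T : Type) (A : set T) : finite_set A ->
  exists (n : nat) (c : 'I_n -> T),
    injective c /\ forall x, A x <-> exists k, c k = x.
Proof.
move=> fA; have /finite_seqP [s As] : @finite_set {classic T} A by [].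
exists (size (undup s)), (tnth (in_tuple (undup s))); split.
  have inj : injective (tnth (in_tuple (undup s))).
    by apply/tuple_uniqP; rewrite undup_uniq.
  exact: inj.
move=> x; rewrite As /=; split=> [xs|[k <-]].
  have /tnthP [k ->] : (x : {classic T}) \in in_tuple (undup s).
    by rewrite memtE /= mem_undup.
  by exists k.
by rewrite -mem_undup; apply: mem_tnth.
Qed.

Section MakeLinear.
Variables (K : fieldType) (U V : lmodType K) (f : U -> V).

(** A copy of [f] indexed by a proof of its linearity, so that the linear structure can be inferred
    from a proof found in the context. *)
Definition linear_fun (_ : linear f) : U -> V := f.
HB.instance Definition _ (hf : linear f) :=
  GRing.isLinear.Build K U V _ (linear_fun hf) hf.
Definition linear_of (hf : linear f) : {linear U -> V} := linear_fun hf.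

End MakeLinear.

Definition lmorph_of (K : fieldType) (C : hfcat) (V W : lmodule K C)
  (f : forall i, V i -> W i) (hf : forall i, linear (f i))
  (nat : forall i j (u : chom i j) x, f j (lact V u x) = lact W u (f i x)) :
  lmorph V W := @LMorph K C V W (fun i => linear_of (hf i)) nat.

Section Submodules.
Variables (K : fieldType) (C : hfcat).
Implicit Types V W Y E : lmodule K C.

Section SubmoduleType.
Variables (V : lmodule K C) (S : forall i, set (V i)) (hS : is_submodule S).

Definition submod_pred (i : C) : {pred V i} := fun x => `[< S x >].

Fact submod_pred_closed (i : C) : submod_closed (@submod_pred i).
Proof.
split=> [|a x y]; rewrite ?unfold_in; first exact/asboolP/(submod_zero hS).
move=> /asboolP Sx /asboolP Sy; exact/asboolP/(submod_linear hS).
Qed.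

(* The proof [hS] is a parameter of the type so that the vector space structure
   can be inferred. *)
Record submod_ob (h : is_submodule S) (i : C) :=
  SubmodOb { submod_val : V i; _ : submod_val \in @submod_pred i }.

HB.instance Definition _ i := [isSub for @submod_val hS i].
HB.instance Definition _ i := [Choice of submod_ob hS i by <:].
HB.instance Definition _ i :=
  GRing.SubChoice_isSubLmodule.Build K (V i) (@submod_pred i) (submod_ob hS i)
    (submod_pred_closed i).

Lemma submod_valP i (x : submod_ob hS i) : S (val x).
Proof. exact/asboolP/(valP x). Qed.

Definition submod_mk i (x : V i) (Sx : S x) : submod_ob hS i :=
  @SubmodOb hS i x (asboolT Sx).

Definition submodule_act i j (f : chom i j) (x : submod_ob hS i) :
  submod_ob hS j :=
  submod_mk (submod_act hS f (submod_valP x)).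

Fact submodule_act_linear i j (f : chom i j) : linear (submodule_act f).
Proof. by move=> a x y; apply: val_inj; rewrite /= !linearP. Qed.

Fact submodule_act_id i (x : submod_ob hS i) :
  linear_of (submodule_act_linear (idm i)) x = x.
Proof. by apply: val_inj; rewrite /= act_id. Qed.

Fact submodule_act_comp i j k (g : chom j k) (f : chom i j)
  (x : submod_ob hS i) :
  linear_of (submodule_act_linear (ccomp g f)) x =
  linear_of (submodule_act_linear g) (linear_of (submodule_act_linear f) x).
Proof. by apply: val_inj; rewrite /= act_comp. Qed.

Definition submodule : lmodule K C :=
  @LModule K C (submod_ob hS) (fun i j f => linear_of (submodule_act_linear f))
    submodule_act_id submodule_act_comp.

Fact submod_incl_linear i : linear (fun x : submodule i => val x : V i).
Proof. by move=> a x y; rewrite linearP. Qed.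

Definition submod_incl : lmorph submodule V :=
  @lmorph_of K C submodule V (fun i x => val x) submod_incl_linear
    (fun _ _ _ _ => erefl).

Lemma submod_incl_mono : lmono submod_incl.
Proof. by move=> i; apply: val_inj. Qed.

Section Lift.
Variables (W : lmodule K C) (f : lmorph W V) (Sf : forall i x, S (f i x)).
Fact submod_lift_linear i :
  linear (fun x => submod_mk (Sf (i := i) x) : submodule i).
Proof. by move=> a x y; apply: val_inj; rewrite /= linearP. Qed.
Fact submod_lift_nat i j (u : chom i j) x :
  submod_mk (Sf (lact W u x)) = lact submodule u (submod_mk (Sf x)).
Proof. by apply: val_inj; rewrite /= mor_nat. Qed.
Definition submod_lift : lmorph W submodule :=
  lmorph_of submod_lift_linear submod_lift_nat.
End Lift.

End SubmoduleType.

Lemma submodD V (S : forall i, set (V i)) i (x y : V i) :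
  is_submodule S -> S i x -> S i y -> S i (x + y).
Proof. by move=> hS Sx Sy; rewrite -[x]scale1r; apply: submod_linear. Qed.

Lemma submodZ V (S : forall i, set (V i)) i a (x : V i) :
  is_submodule S -> S i x -> S i (a *: x).
Proof.
by move=> hS Sx; rewrite -[_ *: _]addr0; apply: submod_linear (submod_zero _ _).
Qed.

Lemma submodB V (S : forall i, set (V i)) i (x y : V i) :
  is_submodule S -> S i x -> S i y -> S i (x - y).
Proof.
by move=> hS Sx Sy; rewrite -scaleN1r; apply: submodD => //; apply: submodZ.
Qed.

Lemma submod_sum V (S : forall i, set (V i)) i (I : finType) (x : I -> V i) :
  is_submodule S -> (forall k, S i (x k)) -> S i (\sum_k x k).
Proof.
move=> hS Sx; elim/big_ind: _ => [|y z Sy Sz|k _]; first exact: submod_zero.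
  exact: submodD.
exact: Sx.
Qed.

Lemma submod_lincomb V (S : forall i, set (V i)) i (I : finType)
  (a : I -> K) (x : I -> V i) :
  is_submodule S -> (forall k, S i (x k)) -> S i (\sum_k a k *: x k).
Proof. by move=> hS Sx; apply: submod_sum => // k; apply: submodZ. Qed.

Lemma preim_submodule V W (f : lmorph V W) (S : forall i, set (W i)) :
  is_submodule S -> is_submodule (fun i x => S i (f i x)).
Proof.
move=> hS; split=> [i|i a x y Sx Sy|i j u x Sx].
- by rewrite linear0; apply: submod_zero.
- by rewrite linearP; apply: submod_linear.
- by rewrite mor_nat; apply: submod_act.
Qed.

Lemma zero_submodule V : is_submodule (fun i => [set (0 : V i)]%classic).
Proof.
split=> [i|i a x y|i j u x] //= -> //; last by rewrite linear0.
by move=> ->; rewrite scaler0 addr0.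
Qed.

Lemma full_submodule V : is_submodule (fun i => @setT (V i)).
Proof. by split. Qed.

Lemma ker_submodule V W (f : lmorph V W) :
  is_submodule (fun i x => f i x = 0).
Proof. exact: preim_submodule f _ (zero_submodule W). Qed.

Lemma eq_submodule V W (f g : lmorph V W) :
  is_submodule (fun i x => f i x = g i x).
Proof.
split=> [i|i a x y fx fy|i j u x fx]; first by rewrite !linear0.
  by rewrite !linearP fx fy.
by rewrite !mor_nat fx.
Qed.

Lemma cap_submodule V (S T : forall i, set (V i)) :
  is_submodule S -> is_submodule T -> is_submodule (fun i x => S i x /\ T i x).
Proof.
move=> hS hT; split=> [i|i a x y [Sx Tx] [Sy Ty]|i j u x [Sx Tx]].
- by split; apply: submod_zero.
- by split; apply: submod_linear.
- by split; apply: submod_act.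
Qed.

Lemma im_submodule V W (f : lmorph V W) (S : forall i, set (V i)) :
  is_submodule S -> is_submodule (fun i y => exists2 x, S i x & f i x = y).
Proof.
move=> hS; split=> [i|i a _ _ [x Sx <-] [y Sy <-]|i j u _ [x Sx <-]].
- by exists 0; [apply: submod_zero|rewrite linear0].
- by exists (a *: x + y); [apply: submod_linear|rewrite linearP].
- by exists (lact V u x); [apply: submod_act|rewrite mor_nat].
Qed.

Lemma sum_submodule V (S T : forall i, set (V i)) :
  is_submodule S -> is_submodule T ->
  is_submodule (fun i z => exists x y, [/\ S i x, T i y & z = x + y]).
Proof.
move=> hS hT; split=> [i|i a _ _ [x [y [Sx Ty ->]]] [x' [y' [Sx' Ty' ->]]]|
  i j u _ [x [y [Sx Ty ->]]]].
- by exists 0, 0; split; [apply: submod_zero|apply: submod_zero|rewrite addr0].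
- exists (a *: x + x'), (a *: y + y'); split; try exact: submod_linear.
  by rewrite scalerDr addrACA.
- exists (lact V u x), (lact V u y); split; try exact: submod_act.
  by rewrite linearD.
Qed.

Lemma lmono_ker V W (f : lmorph V W) :
  (forall i x, f i x = 0 -> x = 0) -> lmono f.
Proof.
move=> kf i x y fxy; apply/eqP; rewrite -subr_eq0; apply/eqP/kf.
by rewrite linearB fxy subrr.
Qed.

Lemma lmono_eq0 V W (f : lmorph V W) : lmono f ->
  forall i x, f i x = 0 -> x = 0.
Proof. by move=> mf i x fx; apply: (mf i); rewrite fx linear0. Qed.

Definition dsum_fst V W : lmorph (dsum V W) V :=
  @lmorph_of K C (dsum V W) V (fun i x => x.1)
    (fun _ _ _ _ => erefl) (fun _ _ _ _ => erefl).
Definition dsum_snd V W : lmorph (dsum V W) W :=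
  @lmorph_of K C (dsum V W) W (fun i x => x.2)
    (fun _ _ _ _ => erefl) (fun _ _ _ _ => erefl).

Section Pairing.
Variables (X V W : lmodule K C) (f : lmorph X V) (g : lmorph X W).
Fact dsum_pair_linear i : linear (fun x => (f i x, g i x) : dsum V W i).
Proof. by move=> a x y /=; rewrite !linearP. Qed.
Fact dsum_pair_nat i j (u : chom i j) x :
  (f j (lact X u x), g j (lact X u x)) = lact (dsum V W) u (f i x, g i x).
Proof. by rewrite !mor_nat. Qed.
Definition dsum_pair : lmorph X (dsum V W) :=
  lmorph_of dsum_pair_linear dsum_pair_nat.
End Pairing.

Section Copairing.
Variables (X V W : lmodule K C) (f : lmorph V X) (g : lmorph W X).
Fact dsum_copair_linear i :
  linear (fun x : dsum V W i => f i x.1 + g i x.2).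
Proof. by move=> a x y /=; rewrite !linearP scalerDr addrACA. Qed.
Fact dsum_copair_nat i j (u : chom i j) (x : dsum V W i) :
  f j (lact (dsum V W) u x).1 + g j (lact (dsum V W) u x).2 =
  lact X u (f i x.1 + g i x.2).
Proof. by rewrite linearD -!mor_nat. Qed.
Definition dsum_copair : lmorph (dsum V W) X :=
  lmorph_of dsum_copair_linear dsum_copair_nat.
End Copairing.

(** * Morphisms out of the modules A e_i *)

Section Yoneda.
Variables (V : lmodule K C) (i : C) (y : V i).

(** The element [a] of the category algebra acting on [y]; as a function of [a] it is the morphism
    matched with [y] by the Yoneda lemma. *)
Definition yoneda_fun (j : C) (a : Ae K i j) : V j :=
  \sum_(f : chom i j) (a : {ffun _ -> K^o}) f *: lact V f y.

Fact yoneda_linear j : linear (@yoneda_fun j).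
Proof.
move=> c a b; rewrite /yoneda_fun scaler_sumr -big_split /=.
by apply: eq_bigr => f _; rewrite !ffunE scalerDl scalerA.
Qed.

Fact yoneda_nat j k (g : chom j k) (a : Ae K i j) :
  yoneda_fun (lact (Ae K i) g a) = lact V g (yoneda_fun a).
Proof.
rewrite /yoneda_fun linear_sum /=.
rewrite [RHS](partition_big (fun f => ccomp g f) xpredT) //=.
apply: eq_bigr => h _; rewrite ffunE scaler_suml.
by apply: eq_bigr => f /eqP <-; rewrite linearZ /= act_comp.
Qed.

Definition yoneda : lmorph (Ae K i) V := lmorph_of yoneda_linear yoneda_nat.

(** The basis vector of A e_i given by the morphism [f]. *)
Definition Ae_mor j (f : chom i j) : Ae K i j := [ffun g => (g == f)%:R].

Lemma yoneda_mor j (f : chom i j) : yoneda j (Ae_mor f) = lact V f y.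
Proof.
rewrite /= /linear_fun /yoneda_fun (bigD1 f) //= ffunE eqxx scale1r.
by rewrite big1 ?addr0 // => g /negPf gf; rewrite ffunE gf scale0r.
Qed.

Lemma yoneda_id : yoneda i (Ae_mor (idm i)) = y.
Proof. by rewrite yoneda_mor act_id. Qed.

End Yoneda.

Lemma yonedaE V i (y : V i) j (a : Ae K i j) :
  yoneda y j a = \sum_(f : chom i j) (a : {ffun _ -> K^o}) f *: lact V f y.
Proof. by []. Qed.

Lemma Ae_act_mor i j k (g : chom j k) (f : chom i j) :
  lact (Ae K i) g (Ae_mor f) = Ae_mor (ccomp g f).
Proof.
apply/ffunP => h; rewrite !ffunE big_mkcond (bigD1 f) //= big1 ?addr0.
  by rewrite ffunE eqxx eq_sym; case: ifP.
by move=> u /negPf uf; rewrite ffunE uf if_same.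
Qed.

Lemma Ae_morE i j (a : Ae K i j) : a = yoneda (Ae_mor (idm i)) j a.
Proof.
rewrite yonedaE; apply/ffunP => h; rewrite sum_ffunE (bigD1 h) //= big1 ?addr0.
  by rewrite ffunE Ae_act_mor comp_idr ffunE eqxx /= /GRing.scale /= mulr1.
move=> u /negPf uh; rewrite ffunE Ae_act_mor comp_idr ffunE eq_sym uh.
by rewrite /GRing.scale /= mulr0.
Qed.

(** The Yoneda lemma: every basis vector is a translate of the identity, so naturality and linearity
    determine [g] from its value there. *)
Lemma mor_Ae V i (g : lmorph (Ae K i) V) j a :
  g j a = yoneda (g i (Ae_mor (idm i))) j a.
Proof.
rewrite {1}(Ae_morE a) !yonedaE linear_sum; apply: eq_bigr => u _.
by rewrite linearZ /= mor_nat.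
Qed.

End Submodules.

(** * Maximal disjoint submodules and Baer's criterion *)

Section Injectivity.
Variables (K : fieldType) (C : hfcat).
Implicit Types V W X Y E : lmodule K C.

Lemma max_disjoint_submodule V (S0 T : forall i, set (V i)) :
  is_submodule S0 -> (forall i x, S0 i x -> T i x -> x = 0) ->
  exists S : forall i, set (V i),
    [/\ is_submodule S, forall i, (S0 i `<=` S i)%classic,
        forall i x, S i x -> T i x -> x = 0 &
        forall S' : forall i, set (V i), is_submodule S' ->
          (forall i, (S i `<=` S' i)%classic) ->
          (forall i x, S' i x -> T i x -> x = 0) ->
          forall i, (S' i `<=` S i)%classic].
Proof.
move=> hS0 dS0.
(* A family of subsets is encoded as one set of pairs (object, element), so that Zorn's lemma for
   unions of chains of sets applies. *)
pose fib (A : set {i : C & V i}) i : set (V i) := fun x => A (existT _ i x).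
pose good A := [/\ is_submodule (fib A), forall i, (S0 i `<=` fib A i)%classic
  & forall i x, fib A i x -> T i x -> x = 0].
have tot (S : forall i, set (V i)) : exists A, forall i, fib A i = S i.
  by exists (fun p => S (projT1 p) (projT2 p)).
case: (@Zorn_bigcup _ (fun A => A = set0%classic \/ good A)) =>
  [F FP Ftot|A [PA Amax]].
  case: (pselect (exists2 A, F A & good A)) => [[A FA gA]|nF]; last first.
    left; apply/seteqP; split=> // p [A FA Ap].
    by case: (FP _ FA) => [A0|gA]; [rewrite A0 in Ap|case: nF; exists A].
  right; have gB B p : F B -> B p -> good B.
    by move=> /FP [->|].
  case: (gA) => hA sA dA; split=> [|i x /sA Ax|i x [B FB Bx]]; last first.
  - by case: (gB _ _ FB Bx) => _ _; apply.
  - by exists A.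
  split=> [i|i a x y [B FB Bx] [D FD Dy]|i j u x [B FB Bx]].
  - by exists A => //; apply: submod_zero hA i.
  - case: (Ftot _ _ FB FD) => sub.
      have Dx := sub _ Bx; exists D => //.
      by case: (gB _ _ FD Dy) => hD _ _; apply: (submod_linear hD).
    have By := sub _ Dy; exists B => //.
    by case: (gB _ _ FB Bx) => hB _ _; apply: (submod_linear hB).
  - exists B => //.
    by case: (gB _ _ FB Bx) => hB _ _; apply: (submod_act hB).
have {PA} [hA sA dA] : good A.
  case: PA => // A0; have [A1 eA1] := tot S0.
  have gA1 : good A1.
    have fA1 : fib A1 = S0 by apply: functional_extensionality_dep.
 by rewrite /good fA1; split=> // i.
  (* [A1] contains all zeros, so it is empty only if there are no objects, and then it equals [A].
     Otherwise it contradicts the maximality of the empty set. *)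
  case: (pselect (exists p, A1 p)) => [[p A1p]|nA1]; last first.
    suff <- : A1 = A by [].
    by rewrite A0; apply/seteqP; split=> // p A1p; case: nA1; exists p.
  case: (Amax A1); last by right.
  by rewrite A0; split=> // /(_ p A1p).
exists (fib A); split=> // S' hS' sub dS'.
have [A1 eA1] := tot S'.
have eS : fib A1 = S' by apply: functional_extensionality_dep.
apply: contrapT => /existsNP [i /existsNP [x /not_implyP [S'x nAx]]].
apply: (Amax A1); last first.
  by right; rewrite /good eS; split=> // j y /sA /sub.
split=> [[j y] Ajy|/(_ (existT _ i x))].
  by have := sub j y Ajy; rewrite -eA1.
by apply: contra_not nAx => /(_ _) H; apply: H; rewrite -/(fib A1 i x) eA1.
Qed.

Lemma graph_fun V W (G : forall i, set (dsum V W i)) i y e e' :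
  is_submodule G -> (forall i e, G i (0, e) -> e = 0) ->
  G i (y, e) -> G i (y, e') -> e = e'.
Proof.
move=> hG funG Gye Gye'; apply/eqP; rewrite -subr_eq0; apply/eqP/(funG i).
rewrite -(subrr y); exact: (submodB hG Gye Gye').
Qed.

Lemma graph_lmorph V W (G : forall i, set (dsum V W i)) :
  is_submodule G -> (forall i e, G i (0, e) -> e = 0) ->
  (forall i y, exists e, G i (y, e)) ->
  exists g : lmorph V W, forall i y, G i (y, g i y).
Proof.
move=> hG funG totG.
pose g i y := projT1 (cid (totG i y)).
have gG i y : G i (y, g i y) by rewrite /g; case: cid.
have gE i y e : G i (y, e) -> g i y = e.
  by move=> Gye; apply: (graph_fun hG funG (gG i y)).
have glin i : linear (g i).
  by move=> a x y; apply: gE; apply: (submod_linear hG a (gG i x) (gG i y)).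
have gnat i j (u : chom i j) x : g j (lact V u x) = lact W u (g i x).
  by apply: gE; apply: (submod_act hG u (gG i x)).
by exists (lmorph_of glin gnat).
Qed.

(** A single-valued [G] projects injectively to [Y], so its second projection extends along the
    first. The graph is itself a module and must satisfy [P]. *)
Lemma injective_in_graph (P : lmodule K C -> Prop) Y E
  (G : forall i, set (dsum Y E i)) (hG : is_submodule G) :
  injective_in P E -> P (submodule hG) -> P Y ->
  (forall i e, G i (0, e) -> e = 0) ->
  exists g : lmorph Y E, forall i y e, G i (y, e) -> g i y = e.
Proof.
move=> injE PG PY funG.
pose m := lmorph_comp (dsum_fst Y E) (submod_incl hG).
pose f := lmorph_comp (dsum_snd Y E) (submod_incl hG).
have mm : lmono m.
  apply: lmono_ker => i [[y e] Gye] y0; apply: val_inj => /=.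
  have {}y0 : y = 0 := y0.
  by move: Gye; rewrite y0 => /asboolP /funG ->.
have [g gm] := injE _ _ m f PG PY mm.
exists g => i y e Gye.
exact: (congr1 (fun h : lmorph (submodule hG) E => h i (submod_mk hG Gye)) gm).
Qed.

(* Baer's criterion, for the projective generators [Ae j]. *)
Definition Baer_condition E : Prop :=
  forall (j : C) (G : forall k, set (dsum (Ae K j) E k)), is_submodule G ->
    (forall k e, G k (0, e) -> e = 0) ->
    exists e : E j, forall k a x, G k (a, x) -> x = yoneda e k a.

(** A maximal single-valued submodule [G] containing the graph of the given partial map is total:
    for any [y], the pullback of [G] along [yoneda y] is a partial map on some A e_j, and the
    criterion supplies a value [e] that can be assigned to [y]. *)
Lemma Baer_injective E : Baer_condition E -> injective_module E.
Proof.
move=> baerE X Y m f _ _ mono_m.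
pose G0 i : set (dsum Y E i) :=
  fun z => exists2 x, True & dsum_pair m f i x = z.
have hG0 : is_submodule G0 := im_submodule (dsum_pair m f) (full_submodule X).
(* Meeting the elements of zero first component trivially means being single-valued. *)
have [|G [hG G0G funG Gmax]] :=
  @max_disjoint_submodule (dsum Y E) G0 (fun i z => z.1 = 0) hG0.
  move=> i z [x _ <-] /= mx0.
  by have x0 := lmono_eq0 mono_m mx0; rewrite x0 linear0.
have {}funG i e : G i (0, e) -> e = 0.
  by move=> /funG /= /(_ erefl) /(congr1 snd).
have totG j y : exists e, G j (y, e).
  pose t := dsum_pair (lmorph_comp (yoneda y) (dsum_fst (Ae K j) E))
              (dsum_snd (Ae K j) E).
  have hG' := preim_submodule t hG.
  have [|e eE] := baerE j _ hG'.
    by move=> k e; rewrite -[t k _]/(yoneda y k 0, e) linear0 => /funG.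
  (* [H] is [G] enlarged by the submodule generated by [(y, e)]. *)
  pose H k (z : dsum Y E k) := exists x x',
    [/\ G k x, (exists2 a, True & dsum_pair (yoneda y) (yoneda e) k a = x')
      & z = x + x'].
  have hH : is_submodule H.
    exact: sum_submodule hG
      (im_submodule (dsum_pair (yoneda y) (yoneda e)) (full_submodule _)).
  have HG : (H j `<=` G j)%classic.
    apply: Gmax => [//|i z Gz|i z [[g1 g2] [_ [Gg [a _ <-] ->]]] /= /eqP].
      exists z, 0; split; rewrite ?addr0 //.
      by exists 0; rewrite ?linear0.
    (* The first component of an element of [H] vanishes only if its part in [G] lies over [- a]
       applied to [y]; by the choice of [e] the second components then cancel too. *)
    rewrite addr_eq0 -linearN => /eqP g1E.
    have := eE i (- a) g2; rewrite /= g1E in Gg * => /(_ Gg).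
    by rewrite linearN => ->; congr pair; rewrite ?g1E linearN addNr.
  exists e; apply: HG; exists 0, (y, e); split; rewrite ?add0r //.
    exact: submod_zero hG j.
  exists (Ae_mor K (idm j)) => //.
  transitivity (yoneda y j (Ae_mor K (idm j)), yoneda e j (Ae_mor K (idm j))).
    by [].

  by rewrite !yoneda_id.
have [g gG] := graph_lmorph hG funG totG.
exists g; apply: lmorph_eqP => i x /=.
have Gx : G i (m i x, f i x) by apply: G0G; exists x.
exact: (graph_fun hG funG (gG i (m i x))).
Qed.

End Injectivity.

(** * Generation, injectivity and projectivity of sums *)

Section Generation.
Variables (K : fieldType) (C : hfcat).
Implicit Types V W X Y E : lmodule K C.

(** The linear combinations of translates of the [b t] form a submodule containing the generators,
    so minimality places [S] inside it. An arbitrary finite index type spares later reindexing. *)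
Lemma sub_finitely_generatedI V (S : forall i, set (V i)) (T : finType)
  (d : T -> C) (b : forall t, V (d t)) :
  (forall t, S (d t) (b t)) ->
  (forall S' : forall i, set (V i), is_submodule S' ->
    (forall t, S' (d t) (b t)) -> forall j x, S j x -> S' j x) ->
  sub_finitely_generated S.
Proof.
move=> Sb minS.
exists #|T|, (fun k => d (enum_val k)), (fun k => b (enum_val k)).
split=> // j x Sx.
pose g j (p : {t & chom (d t) j}) := lact V (tagged p) (b (tag p)).
pose S' j (x : V j) := exists a : {t & chom (d t) j} -> K,
  x = \sum_p a p *: g j p.
have hS' : is_submodule S'.
  split=> [i|i c _ _ [a ->] [a' ->]|i k u _ [a ->]].
  - by exists (fun=> 0); rewrite big1 // => p _; rewrite scale0r.
  - exists (fun p => c * a p + a' p); rewrite scaler_sumr -big_split.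
    by apply: eq_bigr => p _; rewrite scalerDl scalerA.
  (* Acting by [u] moves the coefficient of each morphism to its composite with [u]; coefficients
     with the same composite are added. *)
  - pose push (p : {t & chom (d t) i}) : {t & chom (d t) k} :=
      Tagged (fun t => chom (d t) k) (ccomp u (tagged p)).
    exists (fun q => \sum_(p | push p == q) a p); rewrite linear_sum.
    rewrite (partition_big push xpredT) //; apply: eq_bigr => q _.
    rewrite scaler_suml; apply: eq_bigr => p /eqP <-.
    by rewrite linearZ /g /= act_comp.
have [|a ->] := minS S' hS' _ j x Sx.
  move=> t; pose q : {t' & chom (d t') (d t)} :=
    Tagged (fun t' => chom (d t') (d t)) (idm (d t)).
  exists (fun p => (p == q)%:R).
  rewrite (bigD1 q) //= eqxx scale1r big1 ?addr0 => [|p /negPf ->].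
    by rewrite /g /= act_id.
  by rewrite scale0r.
exists (fun k f => a (Tagged (fun t => chom (d t) j) f)).
pose G t (f : chom (d t) j) :=
  a (Tagged (fun t => chom (d t) j) f) *: lact V f (b t).
transitivity (\sum_t \sum_f G t f); last first.
  by rewrite -(big_enum_val (A := T) (fun t => \sum_f G t f)).
rewrite (sig_big_dep (fun=> true) (fun _ _ => true) G).
by apply: eq_bigr => -[].
Qed.

Lemma sub_finitely_generatedE V (S : forall i, set (V i)) :
  sub_finitely_generated S ->
  exists (n : nat) (d : 'I_n -> C) (b : forall k, V (d k)),
    (forall k, S (d k) (b k)) /\
    forall S' : forall i, set (V i), is_submodule S' ->
      (forall k, S' (d k) (b k)) -> forall j x, S j x -> S' j x.
Proof.
move=> [n [d [b [Sb gen]]]]; exists n, d, b; split=> //.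
move=> S' hS' S'b j x /gen [a ->].
apply: submod_sum => // k; apply: submod_lincomb => // f.
exact: submod_act.
Qed.

(** The image of [f] is finitely generated by noetherianity, and injectivity carries its generators
    back to [V]. *)
Lemma finitely_generated_mono V W (f : lmorph V W) :
  locally_noetherian K C -> lmono f ->
  finitely_generated W -> finitely_generated V.
Proof.
move=> noeth mf fgW.
have /sub_finitely_generatedE [n [d [b [Sb gen]]]] :=
  noeth W fgW _ (im_submodule f (full_submodule V)).
pose c k := s2val (cid2 (Sb k)).
have fc k : f (d k) (c k) = b k by rewrite /c; case: cid2.
apply: (@sub_finitely_generatedI V _ _ d c) => // S' hS' S'c j x _.
have [k||y S'y /mf <- //] := gen _ (im_submodule f hS') _ j (f j x).
  by exists (c k).
by exists x.
Qed.

Lemma finitely_generated_epi V W (f : lmorph V W) :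
  lepi f -> finitely_generated V -> finitely_generated W.
Proof.
move=> ef /sub_finitely_generatedE [n [d [b [_ gen]]]].
apply: (@sub_finitely_generatedI W _ _ d (fun k => f _ (b k))) => //.
move=> S' hS' S'b j y _.
have [x <-] := ef j y.
exact: (gen _ (preim_submodule f hS')).
Qed.

Lemma finitely_generated_Ae (i : C) : finitely_generated (Ae K i).
Proof.
apply: (@sub_finitely_generatedI (Ae K i) _ unit (fun=> i)
  (fun=> Ae_mor K (idm i))) => // S' hS' S'1 j x _.
rewrite (Ae_morE x) yonedaE.
apply: (@submod_lincomb K C (Ae K i) S' j _ _ _ hS') => f.
exact: (submod_act hS' f (S'1 tt)).
Qed.

Lemma finitely_generated_dsum V W :
  finitely_generated V -> finitely_generated W ->
  finitely_generated (dsum V W).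
Proof.
move=> /sub_finitely_generatedE [n [d [b [_ gen]]]].
move=> /sub_finitely_generatedE [m [d' [b' [_ gen']]]].
pose dd (t : 'I_n + 'I_m) := match t with inl k => d k | inr k => d' k end.
pose bb t : dsum V W (dd t) :=
  match t with inl k => (b k, 0) | inr k => (0, b' k) end.
apply: (@sub_finitely_generatedI (dsum V W) _ _ dd bb) => //.
move=> S' hS' S'b j [x y] _.
have -> : (x, y) = dsum_pair (lmorph_id V) (0 : lmorph V W) j x
    + dsum_pair (0 : lmorph W V) (lmorph_id W) j y.
  by congr pair; rewrite /= ?addr0 ?add0r.
apply: submodD => //.
  apply: (gen _ (preim_submodule (dsum_pair (lmorph_id V) 0) hS')) => // k.
  exact: (S'b (inl k)).
apply: (gen' _ (preim_submodule (dsum_pair 0 (lmorph_id W)) hS')) => // k.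
exact: (S'b (inr k)).
Qed.

Definition zero_module : lmodule K C :=
  @LModule K C (fun=> 'rV[K]_0) (fun _ _ _ => idfun)
    (fun _ _ => erefl) (fun _ _ _ _ _ _ => erefl).

Lemma zero_moduleP : is_zero zero_module.
Proof. by move=> i x; apply/matrixP => a []. Qed.

Lemma finitely_generated_zero : finitely_generated zero_module.
Proof.
apply: (@sub_finitely_generatedI _ _ void (fun v => match v with end)
  (fun v => match v with end)) => [[]|S' hS' _ j x _].
by rewrite (zero_moduleP x); apply: submod_zero.
Qed.

(** Bundles finitely many maps into one map to their direct sum, whose kernel is contained in each
    of theirs. [P] records whatever properties of the targets survive finite sums. *)
Lemma joint_source (P : lmodule K C -> Prop) V n (W : 'I_n -> lmodule K C)
  (f : forall k, lmorph V (W k)) :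
  P zero_module -> (forall X Y, P X -> P Y -> P (dsum X Y)) ->
  (forall k, P (W k)) ->
  exists W0 (p : lmorph V W0),
    P W0 /\ forall i x, p i x = 0 -> forall k, f k i x = 0.
Proof.
move=> P0 PD; elim: n W f => [|n IH] W f PW.
  by exists zero_module, 0; split=> // i x _ [].
have [W0 [p [PW0 kp]]] :=
  IH (fun k => W (lift ord0 k)) (fun k => f (lift ord0 k)) (fun k => PW _).
exists (dsum (W ord0) W0), (dsum_pair (f ord0) p); split; first exact: PD.
move=> i x [f0 /kp fk] k; by case: (unliftP ord0 k) => [l|] ->.
Qed.

Lemma joint_target (P : lmodule K C -> Prop) V n (W : 'I_n -> lmodule K C)
  (f : forall k, lmorph (W k) V) :
  P zero_module -> (forall X Y, P X -> P Y -> P (dsum X Y)) ->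
  (forall k, P (W k)) ->
  exists W0 (p : lmorph W0 V),
    P W0 /\ forall k i x, exists y, p i y = f k i x.
Proof.
move=> P0 PD; elim: n W f => [|n IH] W f PW.
  by exists zero_module, 0; split=> // [[]].
have [W0 [p [PW0 kp]]] :=
  IH (fun k => W (lift ord0 k)) (fun k => f (lift ord0 k)) (fun k => PW _).
exists (dsum (W ord0) W0), (dsum_copair (f ord0) p); split; first exact: PD.
move=> k i; case: (unliftP ord0 k) => [l|] -> x.
  have [y py] := kp l i x; exists (0, y).
  rewrite -py; transitivity (f ord0 i 0 + p i y) => //.
  by rewrite linear0 add0r.
exists (x, 0).
by transitivity (f ord0 i x + p i 0) => //; rewrite linear0 addr0.
Qed.

Lemma injective_zero : injective_module zero_module.
Proof.
move=> X Y m f _ _ _; exists 0; apply: lmorph_eqP => i x.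
by rewrite [RHS]zero_moduleP.
Qed.

Lemma injective_dsum V W :
  injective_module V -> injective_module W -> injective_module (dsum V W).
Proof.
move=> iV iW X Y m f _ _ mm.
have [g1 e1] := iV _ _ m (lmorph_comp (dsum_fst V W) f) I I mm.
have [g2 e2] := iW _ _ m (lmorph_comp (dsum_snd V W) f) I I mm.
exists (dsum_pair g1 g2); apply: lmorph_eqP => i x.
transitivity (lmorph_comp g1 m i x, lmorph_comp g2 m i x) => //.
by rewrite e1 e2 /=; case: (f i x).
Qed.

Lemma injective_retract E F (s : lmorph F E) (r : lmorph E F) :
  (forall i x, r i (s i x) = x) -> injective_module E -> injective_module F.
Proof.
move=> rs iE X Y m f _ _ mm.
have [g ge] := iE _ _ m (lmorph_comp s f) I I mm.
exists (lmorph_comp r g); apply: lmorph_eqP => i x.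
transitivity (r i (lmorph_comp g m i x)) => //.
by rewrite ge; apply: rs.
Qed.

Lemma projective_zero : projective_module zero_module.
Proof.
move=> X Y p f _; exists 0; apply: lmorph_eqP => i x.
by rewrite (zero_moduleP x) !linear0.
Qed.

Lemma projective_dsum V W :
  projective_module V -> projective_module W -> projective_module (dsum V W).
Proof.
move=> pV pW X Y p f ep.
have [g1 e1] := pV _ _ p (lmorph_comp f (dsum_pair (lmorph_id V) 0)) ep.
have [g2 e2] := pW _ _ p (lmorph_comp f (dsum_pair 0 (lmorph_id W))) ep.
exists (dsum_copair g1 g2); apply: lmorph_eqP => i [x y].
transitivity (lmorph_comp p g1 i x + lmorph_comp p g2 i y).
  exact: (linearD (p i)).
rewrite e1 e2.
transitivity (f i (((x, 0) : dsum V W i) + (0, y))).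
  by rewrite linearD.
by congr (f i _); congr pair; rewrite /= ?addr0 ?add0r.
Qed.

Lemma projective_retract E F (s : lmorph F E) (r : lmorph E F) :
  (forall i x, r i (s i x) = x) -> projective_module E -> projective_module F.
Proof.
move=> rs pE X Y p f ep.
have [g ge] := pE _ _ p (lmorph_comp f r) ep.
exists (lmorph_comp g s); apply: lmorph_eqP => i x.
transitivity (lmorph_comp p g i (s i x)) => //.
by rewrite ge; congr (f i _); apply: rs.
Qed.

(** By the Yoneda lemma it suffices to lift the image of the identity. *)
Lemma projective_Ae (i : C) : projective_module (Ae K i).
Proof.
move=> X Y p f ep; have [x px] := ep i (f i (Ae_mor K (idm i))).
exists (yoneda x); apply: lmorph_eqP => j a.
rewrite (mor_Ae f) (mor_Ae (lmorph_comp p (yoneda x))).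
by rewrite -[in RHS]px -[in RHS](yoneda_id x).
Qed.

End Generation.

(** * Finite-dimensional and cofree modules *)

Section FiniteSpan.
Variable K : fieldType.

(** A subspace inside [S] is enlarged one vector at a time; [n] bounds its codimension and forces
    the process to stop. This gives a subset defined by a proposition a basis and a projection. *)
Lemma set_vspace (vT : vectType K) (S : set vT) : S 0 ->
  (forall a x y, S x -> S y -> S (a *: x + y)) ->
  exists U : {vspace vT}, forall x, x \in U <-> S x.
Proof.
move=> S0 Slin.
have grow n : forall U : {vspace vT}, (forall x, x \in U -> S x) ->
    (\dim {:vT} <= \dim U + n)%N ->
    exists U : {vspace vT}, forall x, x \in U <-> S x.
  elim: n => [|n IH] U US dU.
    exists U => x; split; first exact: US.
    have -> : U = fullv by apply/eqP; rewrite eqEdim subvf -[\dim U]addn0.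
    by rewrite memvf.
  case: (pselect (forall x, S x -> x \in U)) => [SU|].
    by exists U => x; split; [apply: US|apply: SU].
  move=> /existsNP [x /not_implyP [Sx /negP nUx]].
  apply: (IH (U + <[x]>)%VS) => [y /memv_addP [u Uu [_ /vlineP [a ->] ->]]|].
    by rewrite addrC; apply: Slin => //; apply: US.
  suff : (\dim U < \dim (U + <[x]>))%N.
    move=> dlt; rewrite addnS in dU.
    by rewrite (leq_trans dU) // -addSn leq_add2r.
  rewrite (ltn_leqif (dimv_leqif_sup (addvSl _ _))).
  apply: contra nUx => /subvP; apply.
  exact: (subvP (addvSr U <[x]>)) (memv_line x).
apply: (grow (\dim {:vT}) 0%VS) => [x|]; last by rewrite leq_addl.
by rewrite memv0 => /eqP ->.
Qed.

Definition finitely_spanned (U : lmodType K) : Prop :=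
  exists (T : finType) (b : T -> U), forall x, exists a : T -> K,
    x = \sum_t a t *: b t.

Lemma finitely_spanned_ffun (I : finType) (U : lmodType K) :
  finitely_spanned U -> finitely_spanned {ffun I -> U}.
Proof.
move=> [T [b span]].
exists (I * T)%type, (fun p => [ffun i => if i == p.1 then b p.2 else 0]) => x.
have /choice [a xa] := fun i => span (x i).
exists (fun p => a p.1 p.2); apply/ffunP => i.
rewrite sum_ffunE -(pair_bigA _ (fun k t =>
  (a k t *: [ffun i => if i == k then b t else 0]) i)) /=.
rewrite (bigD1 i) //= [X in _ + X]big1 ?addr0 => [|k /negPf ki].
  by rewrite xa; apply: eq_bigr => t _; rewrite !ffunE eqxx.
by apply: big1 => t _; rewrite !ffunE eq_sym ki scaler0.
Qed.

End FiniteSpan.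

Section FiniteDimension.
Variables (K : fieldType) (C : hfcat).
Implicit Types V W X Y E : lmodule K C.

Definition support V : set C := [set i | exists x : V i, x <> 0]%classic.

Definition extend0 V i (x : V i) (j : C) : V j :=
  match pselect (i = j) with
  | left e => eq_rect i (fun j => V j) x j e
  | right _ => 0
  end.

Lemma extend0_id V i (x : V i) : extend0 x i = x.
Proof.
rewrite /extend0; case: pselect => // e.
by rewrite (Prop_irrelevance e erefl).
Qed.

Lemma extend0_ne V i (x : V i) j : i <> j -> extend0 x j = 0.
Proof. by rewrite /extend0; case: pselect. Qed.

Lemma finsupp_extend0 V i (x : V i) : finsupp (extend0 x).
Proof.
apply: (@sub_finite_set _ _ [set i]%classic); last exact: finite_set1.
by move=> j xj /=; apply: contrapT => ij; apply: xj; apply: extend0_ne => /esym.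
Qed.

(** Spanning families at the finitely many objects of the support, extended by zero, together span
    all finitely supported families. Conversely, the support lies in the union of the supports of
    the spanning elements. *)
Lemma finite_dimensionalP V :
  finite_dimensional V <->
  finite_set (support V) /\ forall i, finitely_spanned (V i).
Proof.
split=> [[n [b [fb span]]]|[/finite_set_enum [n [c [injc suppc]]] fV]].
  have spani i (x : V i) : exists a : 'I_n -> K, x = \sum_k a k *: b k i.
    have [a /(_ i)] := span _ (finsupp_extend0 x).
    by rewrite extend0_id => ->; exists a.
  split=> [|i]; last by exists 'I_n, (fun k => b k i) => x; apply: spani.
  apply: (@sub_finite_set _ _
    (\bigcup_(k in [set: 'I_n]) [set i | b k i <> 0])%classic).
    move=> i [x x0]; apply: contrapT => nb; apply: x0.
    have [a ->] := spani i x; apply: big1 => k _.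
    suff -> : b k i = 0 by rewrite scaler0.
    by apply: contrapT => bk; apply: nb; exists k.
  by apply: bigcup_finite => [|k _]; [exact: finite_finset|exact: fb].
pose T l := projT1 (cid (fV (c l))).
pose b l : T l -> V (c l) := projT1 (cid (projT2 (cid (fV (c l))))).
have span l x : exists a : T l -> K, x = \sum_t a t *: b l t.
  exact: (projT2 (cid (projT2 (cid (fV (c l))))) x).
pose P : finType := {l : 'I_n & T l}.
pose bb (p : P) := extend0 (b _ (tagged p)).
exists #|P|, (fun k => bb (enum_val k)).
split=> [k|x _]; first exact: finsupp_extend0.
pose a l := projT1 (cid (span l (x (c l)))).
have xa l : x (c l) = \sum_t a l t *: b l t := projT2 (cid (span l (x (c l)))).
exists (fun k => a _ (tagged (enum_val k : P))) => i.
pose G l (t : T l) : V i := a l t *: extend0 (b l t) i.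
transitivity (\sum_(p : P) G _ (tagged p)); last first.
  by rewrite -(big_enum_val (A := P) (fun p => G _ (tagged p))).
rewrite -(sig_big_dep (fun=> true) (fun _ _ => true) G).
case: (pselect (support V i)) => [/suppc [l li]|ni]; last first.
  have V0 (y : V i) : y = 0 by apply: contrapT => y0; apply: ni; exists y.
  by rewrite [LHS]V0 [RHS]V0.
(* Since [c] is injective, only the block of [l] contributes at the object [c l]. *)
subst i; rewrite (bigD1 l) //= [X in _ + X]big1 ?addr0 => [|l' /eqP l'l].
  by rewrite xa; apply: eq_bigr => t _; rewrite /G extend0_id.
by apply: big1 => t _; rewrite /G extend0_ne ?scaler0 // => /injc.
Qed.

Lemma finite_dimensional_fg V : finite_dimensional V -> finitely_generated V.
Proof.
move=> fdV; have [/finite_set_enum [n [c [_ suppc]]] fV] :=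
  (finite_dimensionalP V).1 fdV.
pose T l := projT1 (cid (fV (c l))).
pose b l : T l -> V (c l) := projT1 (cid (projT2 (cid (fV (c l))))).
have span l x : exists a : T l -> K, x = \sum_t a t *: b l t.
  exact: (projT2 (cid (projT2 (cid (fV (c l))))) x).
apply: (@sub_finitely_generatedI K C V _ {l : 'I_n & T l} (fun p => c (tag p))
  (fun p => b _ (tagged p))) => // S hS Sb j x _.
case: (pselect (x = 0)) => [->|x0]; first exact: submod_zero.
have /suppc [l lj] : support V j by exists x.
subst j; have [a ->] := span l x.
apply: submod_lincomb => // t.
exact: (Sb (Tagged T t)).
Qed.

Lemma finitely_generated_spanned V i :
  finitely_generated V -> finitely_spanned (V i).
Proof.
move=> [n [d [b [_ span]]]].
exists {k & chom (d k) i}, (fun p => lact V (tagged p) (b (tag p))) => x.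
have [a ->] := span i x I; exists (fun p => a _ (tagged p)).
by rewrite (sig_big_dep (fun=> true) (fun _ _ => true)
  (fun k f => a k f *: lact V f (b k))); apply: eq_bigr => -[].
Qed.

(** The support can only shrink, and each [V i] is finitely spanned because [V] is finitely
    generated by noetherianity. *)
Lemma finite_dimensional_mono V W (f : lmorph V W) :
  locally_noetherian K C -> lmono f ->
  finite_dimensional W -> finite_dimensional V.
Proof.
move=> noeth mf fdW; apply/finite_dimensionalP; split=> [|i].
  apply: (@sub_finite_set _ _ (support W)).
    move=> i [x x0]; exists (f i x) => fx0; apply: x0.
    exact: lmono_eq0 mf _ _ fx0.
  by have [] := (finite_dimensionalP W).1 fdW.
apply: finitely_generated_spanned.
exact: finitely_generated_mono noeth mf (finite_dimensional_fg fdW).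
Qed.

Lemma finite_dimensional_zero : finite_dimensional (zero_module K C).
Proof.
exists 0%N, (fun _ _ => 0); split=> [[]//|x _].
by exists (fun=> 0) => i; rewrite [LHS]zero_moduleP big_ord0.
Qed.

Lemma finite_dimensional_dsum V W :
  finite_dimensional V -> finite_dimensional W -> finite_dimensional (dsum V W).
Proof.
move=> fV fW; have [sV _] := (finite_dimensionalP V).1 fV.
have [sW _] := (finite_dimensionalP W).1 fW.
apply/finite_dimensionalP; split=> [|i].
  apply: (@sub_finite_set _ _ (support V `|` support W)%classic).
    move=> i [[x y] xy0]; apply: contrapT => /not_orP [nx ny]; apply: xy0.
    congr pair.
      by apply: contrapT => x0; apply: nx; exists x.
    by apply: contrapT => y0; apply: ny; exists y.
  by rewrite finite_setU.
apply: finitely_generated_spanned.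
by apply: finitely_generated_dsum; apply: finite_dimensional_fg.
Qed.

(** * Cofree modules *)

Section Cofree.
Variables (i : C) (U : lmodType K).

(** The action on j |-> U^C(j, i), the value at [U] of the right adjoint to evaluation at [i]. *)
Definition cofree_fun j k (f : chom j k) (a : {ffun chom j i -> U}) :
  {ffun chom k i -> U} := [ffun h => a (ccomp h f)].

Fact cofree_linear j k (f : chom j k) : linear (cofree_fun f).
Proof. by move=> c a b; apply/ffunP => h; rewrite !ffunE. Qed.

Fact cofree_id j a : linear_of (cofree_linear (idm j)) a = a.
Proof. by apply/ffunP => h; rewrite ffunE comp_idr. Qed.

Fact cofree_comp j k l (g : chom k l) (f : chom j k) a :
  linear_of (cofree_linear (ccomp g f)) a =
  linear_of (cofree_linear g) (linear_of (cofree_linear f) a).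
Proof. by apply/ffunP => h; rewrite !ffunE Defs.compA. Qed.

Definition cofree : lmodule K C :=
  @LModule K C (fun j => {ffun chom j i -> U})
    (fun j k f => linear_of (cofree_linear f)) cofree_id cofree_comp.

Lemma cofree_actE j k (f : chom j k) (a : cofree j) (h : chom k i) :
  (lact cofree f a : {ffun _ -> U}) h = (a : {ffun _ -> U}) (ccomp h f).
Proof. by rewrite /= ffunE. Qed.

(** Evaluation at the identity of [i] turns a partial map into a linear map on a subspace of K C(j,
    i), and over a field such a map extends. *)
Lemma injective_cofree : injective_module cofree.
Proof.
apply: Baer_injective => j G hG funG.
pose D : set {ffun chom j i -> K^o} :=
  fun a => exists x : cofree i, G i (a, x).
have [||U0 UD] := @set_vspace K {ffun chom j i -> K^o} D.
- by exists 0; apply: (submod_zero hG i).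
- move=> c a b [x Gx] [y Gy]; exists (c *: x + y).
  exact: (submod_linear hG c Gx Gy).
(* The default 0 is never reached: [phi] is only evaluated inside [D], either on [G] or after
   projection onto [U0]. *)
pose phi (a : {ffun chom j i -> K^o}) : U :=
  match pselect (D a) with
  | left Da => (projT1 (cid Da) : {ffun _ -> U}) (idm i)
  | right _ => 0
  end.
have phiE a (x : cofree i) : G i (a, x) -> phi a = (x : {ffun _ -> U}) (idm i).
  rewrite /phi; case: pselect => [Da|nD] Gx; last by case: nD; exists x.
  by case: cid => y /= Gy; rewrite (graph_fun hG funG Gx Gy).
pose g a := phi (projv U0 a).
have glin : linear g.
  move=> c a b; rewrite /g linearP.
  have [x Gx] := (UD _).1 (memv_proj U0 a).
  have [y Gy] := (UD _).1 (memv_proj U0 b).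
  rewrite (phiE _ _ Gx) (phiE _ _ Gy) (phiE _ _ (submod_linear hG c Gx Gy)).
  by rewrite !ffunE.
pose gl := linear_of glin.
exists ([ffun h => gl (Ae_mor K h)] : {ffun chom j i -> U}) => k a x Gax.
apply/ffunP => h.
have Gh := submod_act hG h Gax.
(* The value of [x] at [h] is the value of its translate by [h] at the identity, which the extended
   map computes. *)
transitivity (gl (lact (Ae K j) h a)).
  rewrite /gl /= /linear_fun /g projv_id; last first.
    by apply/UD; exists (lact cofree h x).
  by rewrite (phiE _ _ Gh) cofree_actE comp_idl.
rewrite {1}(Ae_morE a) yonedaE [in LHS]linear_sum linear_sum yonedaE sum_ffunE.
apply: eq_bigr => f _.
by rewrite ffunE cofree_actE ffunE linearZ linearZ /= !Ae_act_mor comp_idr.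
Qed.

(** The support consists of objects with a morphism to [i], and inwards finiteness bounds these. *)
Lemma finite_dimensional_cofree :
  inwards_finite C -> finitely_spanned U -> finite_dimensional cofree.
Proof.
move=> fin fU; apply/finite_dimensionalP; split=> [|j]; last first.
  exact: finitely_spanned_ffun.
apply: sub_finite_set (fin i) => j [x x0]; apply: contrapT => nh; apply: x0.
by apply/ffunP => h; case: nh; split.
Qed.

End Cofree.

Lemma cofree_unit_linear V i j :
  linear (fun x : V j => [ffun h => lact V h x] : cofree i (V i) j).
Proof. by move=> a x y; apply/ffunP => h; rewrite !ffunE linearP. Qed.

Lemma cofree_unit_nat V i j k (u : chom j k) (x : V j) :
  [ffun h => lact V h (lact V u x)] =
  lact (cofree i (V i)) u ([ffun h => lact V h x] : cofree i (V i) j).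
Proof. by apply/ffunP => h; rewrite cofree_actE !ffunE act_comp. Qed.

Definition cofree_unit V i : lmorph V (cofree i (V i)) :=
  lmorph_of (@cofree_unit_linear V i) (@cofree_unit_nat V i).

(** The units of the adjunction at the objects of the support are jointly injective: at [i], the
    coordinate at the identity recovers the vector. *)
Lemma finite_dimensional_embed V : inwards_finite C -> finite_dimensional V ->
  exists E (m : lmorph V E),
    [/\ finite_dimensional E, injective_module E & lmono m].
Proof.
move=> fin fdV; have [/finite_set_enum [n [c [_ suppc]]] fV] :=
  (finite_dimensionalP V).1 fdV.
have [|||E [m [[fdE iE] km]]] :=
  @joint_source K C (fun E => finite_dimensional E /\ injective_module E)
    V n _ (fun k => cofree_unit V (c k)).
- by split; [apply: finite_dimensional_zero|apply: injective_zero].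
- move=> X Y [? ?] [? ?].
  by split; [apply: finite_dimensional_dsum|apply: injective_dsum].
- move=> k; split; last exact: injective_cofree.
  exact: finite_dimensional_cofree.
exists E, m; split=> //; apply: lmono_ker => i x mx0.
apply: contrapT => x0; apply: (x0).
have /suppc [k ki] : support V i by exists x.
subst i; have /ffunP /(_ (idm (c k))) := km _ _ mx0 k.
by rewrite !ffunE act_id.
Qed.

End FiniteDimension.

(** * Embeddings into injective modules *)

Section Nakayama.
Variables (K : fieldType) (C : hfcat).
Implicit Types V W X Y E : lmodule K C.

Lemma lmorph_neq0 V W (f : lmorph V W) : f <> 0 -> exists i x, f i x <> 0.
Proof.
move=> f0; apply: contrapT => nf; apply: f0; apply: lmorph_eqP => i x.
by apply: contrapT => fx; apply: nf; exists i, x.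
Qed.

Lemma nakayama_zeroP V :
  is_zero (nakayama V) <-> forall (i : C) (f : lmorph V (Ae K i)), f = 0.
Proof.
split=> [z i f|z i u]; last first.
  by apply: linear_eqP => f; rewrite (z i f) linear0.
apply: contrapT => /lmorph_neq0 [j [x fx]]; apply: fx; apply/ffunP => h.
pose ev (g : lmorph V (Ae K i)) : K^o := (g j x : {ffun _ -> K^o}) h.
have ev_linear : linear ev by move=> a g g'; rewrite /ev /= !ffunE.
rewrite [RHS]ffunE; exact: (congr1
  (fun u : kdual (homA V i) => (u : {linear homA V i -> K^o}) f)
  (z i (linear_of ev_linear))).
Qed.

Lemma eq_on_generators V W (f g : lmorph V W) n (d : 'I_n -> C)
  (b : forall k, V (d k)) :
  (forall S' : forall i, set (V i), is_submodule S' ->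
     (forall k, S' (d k) (b k)) -> forall j x, setT x -> S' j x) ->
  (forall k, f _ (b k) = g _ (b k)) -> f = g.
Proof.
by move=> gen fg; apply: lmorph_eqP => i x; apply: (gen _ (eq_submodule f g)).
Qed.

(** Finitely many maps to the modules A e_l already have the common kernel of all of them: only
    finitely many [l] admit nonzero maps, and each space of maps is finite-dimensional. *)
Lemma Ae_cogenerated V (P : lmodule K C -> Prop) :
  inwards_finite C -> finitely_generated V ->
  P (zero_module K C) -> (forall X Y, P X -> P Y -> P (dsum X Y)) ->
  (forall l : C, P (Ae K l)) ->
  exists W (p : lmorph V W), P W /\
    forall i x, p i x = 0 -> forall (l : C) (f : lmorph V (Ae K l)), f i x = 0.
Proof.
move=> fin /sub_finitely_generatedE [n [d [b [_ gen]]]] P0 PD PA.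
(* [Hom(V, A e_l)] embeds in [\prod_k K C(l, d k)], so finitely many maps to
   [A e_l] suffice. *)
have one l : exists W (p : lmorph V W), P W /\
    forall i x, p i x = 0 -> forall f : lmorph V (Ae K l), f i x = 0.
  pose vT : vectType K := {ffun {k & chom l (d k)} -> K^o}.
  pose ev (f : lmorph V (Ae K l)) : vT :=
    [ffun p => (f _ (b (tag p)) : {ffun _ -> K^o}) (tagged p)].
  have ev_linear : linear ev by move=> a f g; apply/ffunP => p; rewrite !ffunE.
  have ev_inj f g : ev f = ev g -> f = g.
    move=> efg; apply: (eq_on_generators gen) => k; apply/ffunP => h.
    have /ffunP /(_ (Tagged (fun k => chom l (d k)) h)) := efg;
    by rewrite !ffunE.
  have [||U evU] := @set_vspace K vT (fun v => exists f, ev f = v).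
  - by exists 0; apply: (linear0 (linear_of ev_linear)).
  - by move=> a _ _ [f <-] [g <-]; exists (a *: f + g); apply: ev_linear.
  have fk (k : 'I_(\dim U)) : exists f, ev f = (vbasis U)`_k.
    by apply/evU/vbasis_mem/mem_nth; rewrite size_tuple.
  have {fk} [F evF] := choice fk.
  have [W [p [PW kp]]] := joint_source F P0 PD (fun=> PA l).
  exists W, p; split=> // i x px f.
  have fU : ev f \in U by apply/evU; exists f.
  suff -> : f = \sum_k coord (vbasis U) k (ev f) *: F k.
    have ev_at : linear (fun g : lmorph V (Ae K l) => g i x) by [].
    rewrite -[LHS]/(linear_of ev_at _) linear_sum big1 // => k _.
    by rewrite linearZ /= /linear_fun (kp _ _ px) scaler0.
  apply: ev_inj; rewrite {1}(coord_vbasis fU).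
  rewrite -[RHS]/(linear_of ev_linear _) linear_sum.
  by apply: eq_bigr => k _; rewrite linearZ /= /linear_fun evF.
(* A nonzero map to A e_l is nonzero on some generator, which requires a morphism from [l] to its
   degree. *)
have /finite_set_enum [m [c [_ suppc]]] :
    finite_set (\bigcup_(k in [set: 'I_n])
      [set l : C | inhabited (chom l (d k))])%classic.
  by apply: bigcup_finite => // k _; apply: fin.
pose W k := projT1 (cid (one (c k))).
pose p k : lmorph V (W k) := projT1 (cid (projT2 (cid (one (c k))))).
have pP k : P (W k) /\ forall i x, p k i x = 0 ->
    forall f : lmorph V (Ae K (c k)), f i x = 0.
  exact: (projT2 (cid (projT2 (cid (one (c k)))))).
have [W0 [p0 [PW0 kp0]]] := joint_source p P0 PD (fun k => (pP k).1).
exists W0, p0; split=> // i x p0x l f.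
case: (pselect (exists k, c k = l)) => [[k kl]|nl].
  by subst l; apply: (pP k).2; apply: kp0.
suff -> : f = 0 by [].
apply: (eq_on_generators gen) => k; apply/ffunP => h; case: nl.
by apply/suppc; exists k.
Qed.

(** In Baer's criterion the graph is a submodule of the sum of A e_j and [E], hence finitely
    generated; testing injectivity on finitely generated modules is therefore enough. *)
Lemma finitely_generated_injective E :
  locally_noetherian K C -> finitely_generated E ->
  injective_in (@finitely_generated K C) E -> injective_module E.
Proof.
move=> noeth fgE iE; apply: Baer_injective => j G hG funG.
have fgAe := finitely_generated_Ae K j.
have fgG : finitely_generated (submodule hG).
  apply: (finitely_generated_mono noeth (@submod_incl_mono _ _ _ _ hG)).
  exact: finitely_generated_dsum.
have [g gG] := injective_in_graph iE fgG fgAe funG.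
by exists (g j (Ae_mor K (idm j))) => k a x /gG <-; apply: mor_Ae.
Qed.

(* The torsion part [T] of [V], on which all maps to the [A e_l] vanish, admits
   no nonzero map to any [A e_l] because the latter are injective. *)
Lemma embed_fd_projective V :
  inwards_finite C -> locally_noetherian K C -> locally_self_injective K C ->
  (forall W, finitely_generated W ->
     (forall (l : C) (f : lmorph W (Ae K l)), f = 0) -> finite_dimensional W) ->
  finitely_generated V ->
  exists X Y (m : lmorph V (dsum X Y)),
    [/\ finite_dimensional X, injective_module X,
        [/\ finitely_generated Y, injective_module Y & projective_module Y]
      & lmono m].
Proof.
move=> fin noeth self fdtors fgV.
have [||l|Y [p [[fgY iY pY] kp]]] := @Ae_cogenerated V (fun Y =>
  [/\ finitely_generated Y, injective_module Y & projective_module Y]) fin fgV.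
- split; [exact: finitely_generated_zero|exact: injective_zero|].
  exact: projective_zero.
- move=> X Y [? ? ?] [? ? ?]; split; [exact: finitely_generated_dsum| |].
    exact: injective_dsum.
  exact: projective_dsum.
- split; [exact: finitely_generated_Ae|exact: self|exact: projective_Ae].
have hT := ker_submodule p; set T := submodule hT.
have fgT : finitely_generated T.
  exact: finitely_generated_mono noeth (@submod_incl_mono _ _ _ _ hT) fgV.
have fdT : finite_dimensional T.
  apply: fdtors => // l f; apply: lmorph_eqP => i x.
  have [g <-] :=
    self l _ _ (submod_incl hT) f I I (@submod_incl_mono _ _ _ _ hT).
  exact: kp (submod_valP x) _ _.
have [X [m [fdX iX mm]]] := finite_dimensional_embed fin fdT.
(* The embedding of the torsion part extends to [V]; paired with [p] it is injective, since [q]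
   agrees with [m] on the kernel of [p]. *)
have [q qm] := iX _ _ (submod_incl hT) m I I (@submod_incl_mono _ _ _ _ hT).
exists X, Y, (dsum_pair q p); split=> //; apply: lmono_ker => i x qpx.
have /= qx : q i x = 0 := congr1 fst qpx.
have /= px : p i x = 0 := congr1 snd qpx.
have := congr1 (fun h : lmorph T X => h i (submod_mk hT px)) qm.
by rewrite /= /linear_fun /= qx => /esym /(lmono_eq0 mm) /(congr1 val).
Qed.

(* An injective module is the direct sum of a maximal submodule [Q] meeting the
   kernel of [p] trivially and a maximal submodule [F] that contains this kernel
   and meets [Q] trivially. *)
Lemma injective_split E X Y (q : lmorph E X) (p : lmorph E Y) :
  injective_module E -> lmono (dsum_pair q p) ->
  exists F Q (sF : lmorph F E) (rF : lmorph E F) (sQ : lmorph Q E)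
         (rQ : lmorph E Q),
    [/\ forall i x, rF i (sF i x) = x, forall i x, rQ i (sQ i x) = x,
        isomorphic E (dsum F Q), lmono (lmorph_comp q sF)
      & lmono (lmorph_comp p sQ)].
Proof.
move=> iE mqp.
have hK := ker_submodule p.
have [|Q [hQ _ QK Qmax]] :=
  @max_disjoint_submodule K C E _ (fun i x => p i x = 0) (zero_submodule E).
  by move=> i x /= ->.
have [|F [hF KF FQ Fmax]] := @max_disjoint_submodule K C E _ Q hK.
  by move=> i x px Qx; apply: QK.
(* The graph of the projection of F + Q onto F along Q. Its extension [g] to [E] turns out to be an
   idempotent with image F and kernel Q. *)
pose G i (z : dsum E E i) := F i z.2 /\ Q i (z.1 - z.2).
have hG : is_submodule G.
  exact: cap_submodule (preim_submodule (dsum_snd E E) hF)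
    (preim_submodule (dsum_fst E E - dsum_snd E E) hQ).
have [|g gG] := @injective_in_graph K C _ E E G hG iE I I.
  move=> i e [/= Fe]; rewrite sub0r => Qe; apply: (FQ _ _ Fe).
  by rewrite -[e]opprK -scaleN1r; apply: submodZ.
have gF i x : F i x -> g i x = x.
  move=> Fx; apply: gG; split=> //=; rewrite subrr; exact: submod_zero.
have gQ i y : Q i y -> g i y = 0.
  move=> Qy; apply: gG; split=> /=; first exact: submod_zero.
  by rewrite subr0.
(* The kernel of [g] contains Q and meets the kernel of [p] trivially, as [g] fixes F; maximality of
   Q applies. *)
have kerg i x : g i x = 0 -> Q i x.
  apply: (Qmax _ (ker_submodule g)) => [j y /gQ //|j y gy py].
  by rewrite -(gF _ _ (KF _ _ py)).
(* The preimage of Q under [g] is Q, again by maximality, so the image of [g] meets Q trivially. It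
   contains F and hence equals F. *)
have img i x : F i (g i x).
  apply: (Fmax _ (im_submodule g (full_submodule E))) => [j y Fy|j _ [y _ <-]|].
  - by exists y => //; apply: gF.
  - suff : Q j (g j y) -> Q j y by move=> H /H /gQ.
    apply: (Qmax _ (preim_submodule g hQ)) => [k z /gQ ->|k z Qgz pz].
      exact: submod_zero.
    by apply: (QK _ _ _ pz); rewrite -(gF _ _ (KF _ _ pz)).
  - by exists x.
have imQ i x : Q i ((lmorph_id E - g) i x).
  by apply: kerg; rewrite /= linearB /= (gF _ _ (img i x)) subrr.
exists (submodule hF), (submodule hQ), (submod_incl hF), (submod_lift hF img),
  (submod_incl hQ), (submod_lift hQ imQ).
have rFs i (x : submodule hF i) : submod_lift hF img i (submod_incl hF i x) = x.
  by apply: val_inj; apply: gF; apply: submod_valP.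
have rQs i (x : submodule hQ i) : submod_lift hQ imQ i (submod_incl hQ i x) = x.
  apply: val_inj; transitivity (val x - g i (val x)) => //.
  by rewrite gQ ?subr0 //; apply: submod_valP.
split=> //.
- exists (dsum_pair (submod_lift hF img) (submod_lift hQ imQ)).
  exists (dsum_copair (submod_incl hF) (submod_incl hQ)).
  split; apply: lmorph_eqP => i x.
    by transitivity (g i x + (x - g i x)) => //; rewrite addrC subrK.
  case: x => x y; have gxy : g i (val x + val y) = val x.
    by rewrite linearD gF ?gQ ?addr0 //; apply: submod_valP.
  congr pair; apply: val_inj => //.
  transitivity (val x + val y - g i (val x + val y)) => //.
  by rewrite gxy addrC addKr.
- apply: lmono_ker => i x qx; apply: val_inj.
  have Fx := submod_valP x; apply: (FQ i) => //.
  (* If y + z lies in the kernel of [p], with y in F killed by [q] and z in Q, then z lies in F and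
     vanishes, so y is killed by both maps. Maximality puts this sum, and with it [x], inside Q. *)
  have hS := sum_submodule (cap_submodule hF (ker_submodule q)) hQ.
  apply: (Qmax _ hS) => [j y Qy|j _ [y [z [[Fy qy] Qz ->]]] pyz|].
  - by exists 0, y; split; rewrite ?add0r ?linear0 //;
      split=> //; apply: submod_zero.
  - have z0 : z = 0.
      apply: FQ => //; have := submodB hF (KF _ _ pyz) Fy.
      by rewrite addrC addKr.
    rewrite z0 addr0 in pyz *; apply: (lmono_eq0 mqp).
    by rewrite -[LHS]/(q j y, p j y) qy pyz.
  - by exists (val x), 0; split; rewrite ?addr0 //; apply: submod_zero.
- apply: lmono_ker => i x px; apply: val_inj.
  by apply: QK px; apply: submod_valP.
Qed.

End Nakayama.

(** Generators give a surjection onto [Q] from a finite sum of modules A e_i. A section of it keeps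
    [u] nonzero, and so some component of the composite is nonzero. *)
Lemma projective_torsionless (K : fieldType) (C : hfcat) (Q V : lmodule K C)
  (u : lmorph V Q) :
  finitely_generated Q -> projective_module Q -> u <> 0 ->
  exists (i : C) (f : lmorph V (Ae K i)), f <> 0.
Proof.
move=> /sub_finitely_generatedE [n [d [b [_ gen]]]] pQ u0.
(* Stated as a property closed under direct sums, so that [joint_target] passes it from the A e_i to
   their sum. *)
pose torsionless (W : lmodule K C) := forall w : lmorph V W,
  w <> 0 -> exists (i : C) (f : lmorph V (Ae K i)), f <> 0.
have [||k|W [p [tW imp]]] :=
  @joint_target K C torsionless Q n _ (fun k => yoneda (b k)).
- by move=> w []; apply: lmorph_eqP => i x; apply: zero_moduleP.
- move=> X Y tX tY w /lmorph_neq0 [i [x wx]].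
  case: (pselect (lmorph_comp (dsum_fst X Y) w = 0)) => [w1|/tX //].
  case: (pselect (lmorph_comp (dsum_snd X Y) w = 0)) => [w2|/tY //].
  case: wx; transitivity (lmorph_comp (dsum_fst X Y) w i x,
    lmorph_comp (dsum_snd X Y) w i x); last by rewrite w1 w2.
  by rewrite /=; case: (w i x).
- by move=> w w0; exists (d k), w.
have ep : lepi p.
  move=> i x.
  have [||y _ py] := gen _ (im_submodule p (full_submodule W)) _ i x.
  - move=> k; have [y py] := imp k (d k) (Ae_mor K (idm (d k))).
    by exists y; rewrite // py yoneda_id.
  - by [].
  - by exists y.
have [s sp] := pQ _ _ p (lmorph_id Q) ep.
apply: (tW (lmorph_comp s u)) => su0; apply: u0; apply: lmorph_eqP => i x.
transitivity (lmorph_comp p s i (u i x)); first by rewrite sp.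
by transitivity (p i (lmorph_comp s u i x)) => //; rewrite su0 linear0.
Qed.

Theorem proposition3p10 (K : fieldType) (C : hfcat)
  (hskel : skeletal C) (hEI : EI_category C) (hin : inwards_finite C)
  (hnoeth : locally_noetherian K C)
  (hchar : [pchar K] =i pred0)
  (hself : locally_self_injective K C) :
  let P1 := forall V : lmodule K C,
    in_ker_nakayama V -> finite_dimensional V in
  let P2 := forall V : lmodule K C,
    finitely_generated V -> ~ finite_dimensional V ->
    exists (i : C) (f : lmorph V (Ae K i)), f <> 0 in
  let P3 := fgmod_enough_injectives K C /\
    forall E : lmodule K C, finitely_generated E -> injective_module E ->
      exists F Q : lmodule K C,
        [/\ finite_dimensional F, injective_module F,
            finitely_generated Q, projective_module Q
          & isomorphic E (dsum F Q)] in
  (P1 <-> P2) /\ (P2 <-> P3).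
Proof.
move=> P1 P2 P3; split; split.
- move=> p1 V fgV nfdV; apply: contrapT => nf; apply: nfdV; apply: p1.
  split=> //; apply/nakayama_zeroP => i f; apply: contrapT => f0.
  by apply: nf; exists i, f.
- move=> p2 V [fgV /nakayama_zeroP homs0]; apply: contrapT => nfdV.
  by have [i [f []]] := p2 V fgV nfdV; apply: homs0.
- move=> p2.
  have fdtors W : finitely_generated W ->
      (forall (i : C) (f : lmorph W (Ae K i)), f = 0) -> finite_dimensional W.
    move=> fgW homs0; apply: contrapT => nfdW.
    by have [i [f []]] := p2 W fgW nfdW; apply: homs0.
  have embed V fgV := embed_fd_projective (V := V) hin hnoeth hself fdtors fgV.
  split=> [V fgV|E fgE iE].
    have [X [Y [m [fdX iX [fgY iY _] mm]]]] := embed V fgV.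
    exists (dsum X Y), m; split=> //.
      exact: finitely_generated_dsum (finite_dimensional_fg fdX) fgY.
    by move=> Z W n f _ _; apply: injective_dsum iX iY _ _ n f I I.
  have [X [Y [m [fdX iX [fgY iY pY] mm]]]] := embed E fgE.
  have [|F [Q [sF [rF [sQ [rQ [rsF rsQ iso mF mQ]]]]]]] :=
      @injective_split K C E X Y (lmorph_comp (dsum_fst X Y) m)
        (lmorph_comp (dsum_snd X Y) m) iE.
    apply: lmono_ker => i x mx; apply: (lmono_eq0 mm).
    by rewrite [LHS]surjective_pairing.
  have iQ := injective_retract rsQ iE.
  (* Injectivity of [Q] splits its embedding in [Y], making it a summand of a projective module. *)
  have [r rQm] := iQ _ _ _ (lmorph_id Q) I I mQ.
  exists F, Q; split=> //.
  + exact: finite_dimensional_mono hnoeth mF fdX.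
  + exact: injective_retract rsF iE.
  + exact: finitely_generated_epi (fun i y => ex_intro _ _ (rsQ i y)) fgE.
  + apply: projective_retract pY => i x.
    exact: (congr1 (fun h : lmorph Q Q => h i x) rQm).
- move=> [enough split_inj] V fgV nfdV.
  have [E [m [fgE iE mm]]] := enough V fgV.
  (* The embedding provides injectivity of [E] only among finitely generated modules; it is upgraded
     before splitting [E]. *)
  have [F [Q [fdF _ fgQ pQ [f [g [gf _]]]]]] :=
    split_inj E fgE (finitely_generated_injective hnoeth fgE iE).
  pose u := lmorph_comp f m.
  (* If the component of [V] in [Q] vanished, [V] would embed in the finite-dimensional [F]. *)
  apply: (projective_torsionless (u := lmorph_comp (dsum_snd F Q) u)) => // u0.
  apply: nfdV; apply: (finite_dimensional_mono (W := F)
    (f := lmorph_comp (dsum_fst F Q) u)) => //.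
  apply: lmono_ker => i x ux; apply: (lmono_eq0 mm).
  transitivity (lmorph_comp g f i (m i x)); first by rewrite gf.
  transitivity (g i 0); last exact: linear0.
  congr (g i _); rewrite [LHS]surjective_pairing; congr pair => //.
  exact: (congr1 (fun h : lmorph V Q => h i x) u0).
Qed.
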